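(* Let $s\ge 1$ be a fixed integer, let $p=p(n)\in(0,1)$ be an arbitrary sequence and put $q=1-p$. Let $\nu_n$ be the number of connected components of the random graph $G(n,p)$. Then, as $n\to\infty$, $$ \mathsf{E}(\nu_n-1)^{\underline s} = (1+o(1))\left( \frac 1p \sum_{k=1}^\infty\frac{k^{k-2}}{k!}(npq^n)^k\right)^s + o(1). $$
   Context: $G(n,p)$ is the random graph on $n$ labeled vertices in which each of the $\binom n2$ possible edges is present with probability $p$, independently of the others. $\mathsf{E}$ denotes expectation. For an integer $k\ge 0$, $z^{\underline k}=z(z-1)\cdots(z-k+1)$ denotes the factorial (falling) power, with $z^{\underline 0}=1$. Each $o(1)$ denotes a quantity tending to $0$ as $n\to\infty$ (with $s$ fixed). *)

(* Defs.v *)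
From HB Require Import structures.
From mathcomp Require Import all_boot all_order all_algebra.
From mathcomp Require Import all_classical all_reals all_analysis.

Set Implicit Arguments.
Unset Strict Implicit.
Unset Printing Implicit Defensive.

Import Order.TTheory GRing.Theory Num.Theory.
Import numFieldNormedType.Exports.

Local Open Scope ring_scope.

(* A graph on the vertex set 'I_n is its edge set, a subset of [Kedges n]. *)
Definition Kedges (n : nat) : {set {set 'I_n}} :=
  [set e : {set 'I_n} | #|e| == 2%N]%SET.

Definition adj (n : nat) (G : {set {set 'I_n}}) : rel 'I_n :=
  fun x y => [set x; y]%SET \in G.

Definition ncomponents (n : nat) (G : {set {set 'I_n}}) : nat :=
  n_comp (adj G) 'I_n.

(* The law of G(n,p): the product over all possible edges of Bernoulli(p)
   weights, i.e. the edges are present independently with probability p. *)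
Definition Gnp_weight (R : realType) (n : nat) (p : R)
    (G : {set {set 'I_n}}) : R :=
  \prod_(e in Kedges n) (if e \in G then p else 1 - p).

Definition Gnp_expectation (R : realType) (n : nat) (p : R)
    (X : {set {set 'I_n}} -> R) : R :=
  \sum_(G in powerset (Kedges n)) Gnp_weight p G * X G.

(* For 0 < p < 1 one has n p (1-p)^n < 1/e, the radius of convergence, so the
   limit below is that of a convergent series of reals.  The exponent k - 2 is
   truncated, which is harmless: at k = 1 both 1^(-1) and 1^0 are 1. *)
Definition tree_series (R : realType) (x : R) : R :=
  \big[+%R/0]_(1 <= k <oo) ((k ^ (k - 2))%:R / k`!%:R * x ^+ k).

(* Main.v *)
Require Import Defs.
From HB Require Import structures.
From mathcomp Require Import all_boot all_order all_algebra.
From mathcomp Require Import all_classical all_reals all_analysis.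
From mathcomp Require Import fintype finset ring lra zify.
Import Order.TTheory GRing.Theory Num.Theory.
Import numFieldNormedType.Exports.
Set Implicit Arguments.
Unset Strict Implicit.
Unset Printing Implicit Defensive.
Local Open Scope ring_scope.

(** Fix a vertex v.  Exactly one component contains v, so the falling power
    (nu - 1)^_s counts the ordered s-tuples of distinct components that avoid v.
    Removing the first component of the tuple leaves a random graph on n - k
    vertices that still contains v.  With q = 1 - p and F_s(n) the expectation
    in question ([expectation_moment]) this is the recursion [momentS]
<<
      F_{s+1}(n) = sum_k w(n,k) F_s(n-k),
      w(n,k) = C(n-1,k) kappa_k q^(k(n-k)),
>>
    where kappa_k is the probability that G(k,p) is connected.  If k is bounded
    and p tends to 0, then kappa_k is close to k^(k-2) p^(k-1) by Cayley's
    formula, so that w(n,k) is close to (k^(k-2)/k!) p^(k-1) mu^k with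
    mu = n q^n.  The sum of these numbers over k is
    Lambda = p^-1 sum_k (k^(k-2)/k!) (n p q^n)^k, and induction on s suggests
    F_s(n) ~ Lambda^s.  Everything below makes this uniform in p; the series
    converges uniformly because n p q^n <= 1/e and c_k e^-k <= 1/k^2, where
    c_k = k^(k-2)/k!.

    The exact identities come from a single exploration step.  Let X be the
    number of components that avoid a set of a roots in a graph on these roots
    and m further vertices.  Deleting a root and making its neighbours roots
    preserves X, which yields a binomial recursion for the polynomial
    [compgf a m], the expectation of z^X.  All other identities are proved by
    showing that both sides satisfy this recursion: the derivative in z gives
    the recursion for the factorial moments ([deriv_compgf]), and the value at
    z = 0, which is the probability that every vertex is joined to a root, is
    compared with the number a (a+m)^(m-1) of forests ([nforests_expose]),
    which gives both bounds for kappa_k.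

    The lower bound keeps the sizes k <= K only ([moment_lower]).  In the upper
    bound the terms k <= K are compared with Lambda for small p
    ([main_terms_le]), and the remaining sizes are shown to be negligible.  A
    component that avoids v and has more than n/2 vertices forces v into a small
    component; exchanging the two reduces the sizes k > n/2 to the sizes
    k <= n/2 ([sum_large_by_small]).  For K < k <= n/2 there are two cases.  If
    n p is bounded, then n is at most a constant times mu, and there are at most
    n/K components of size above K ([tail_moderate]).  If n p is large, then the
    tree bound for w(n,k) is geometrically small ([tail_dense]).  If p stays
    away from 0, then all quantities tend to 0 ([moment_large_p]). *)

(** * Components that avoid a set of vertices *)

Section Components.
Local Open Scope set_scope.
Variable n : nat.
Implicit Types (G : {set {set 'I_n}}) (V A B C S : {set 'I_n}) (v x y : 'I_n).

Definition no_edge G B C := [forall x in B, forall y in C, ~~ adj G x y].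

(** Connectedness of the graph induced on [B], expressed by cuts instead of
    paths: no part of [B] is separated from the rest.  In this form it depends
    visibly on the pairs inside [B] only. *)
Definition unsplittable G B :=
  [forall S : {set 'I_n},
     [&& S != set0, S \subset B & no_edge G S (B :\: S)] ==> (S == B)].

Definition component G V B :=
  [&& B != set0, B \subset V, no_edge G B (V :\: B) & unsplittable G B].

Definition ncomp_avoiding G V A :=
  #|[set B | component G V B & [disjoint B & A]]|.

Lemma adjC G x y : adj G x y = adj G y x.
Proof. by rewrite /adj setUC. Qed.

Lemma no_edgeP G B C :
  reflect (forall x y, x \in B -> y \in C -> ~~ adj G x y) (no_edge G B C).
Proof.
apply: (iffP forall_inP) => [H x y xB yC | H x xB].
  by move/forall_inP: (H x xB); apply.
by apply/forall_inP => y yC; apply: H.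
Qed.

(** A component avoids [v] and the other roots iff it survives the deletion of
    [v] and avoids the neighbours of [v]: this is one step of the exploration
    of the components of the roots. *)
Lemma ncomp_avoiding_expose G V A v : v \in A -> A \subset V ->
  ncomp_avoiding G V A =
  ncomp_avoiding G (V :\ v) (A :\ v :|: [set u in V :\: A | adj G v u]).
Proof.
move=> vA AV; apply: eq_card => B; rewrite !inE /component.
have [B0|B0] /= := boolP (B != set0); last by [].
have [_|_] := boolP (unsplittable G B); rewrite !(andbT, andbF) //.
apply/idP/idP => [/andP[/andP[BV /no_edgeP HB] dBA]|].
  have vB : v \notin B.
    by apply/negP => vB; move: (disjointFr dBA vB); rewrite vA.
  apply/andP; split; first (apply/andP; split).
  - apply/fintype.subsetP => x xB; rewrite !inE (fintype.subsetP BV) // andbT.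
    by apply: contraNneq vB => <-.
  - apply/no_edgeP => x y xB; rewrite !inE => /and3P[yB _ yV].
    by apply: HB; rewrite // inE yB.
  - apply/pred0P => x /=; apply/negP => /andP[xB]; rewrite !inE => /orP[/andP[_ xA]|].
      by move: (disjointFr dBA xB); rewrite xA.
    move=> /andP[/andP[_ xV] vx]; have := HB x v xB.
    by rewrite inE vB (fintype.subsetP AV) // adjC vx => /(_ isT).
move=> /andP[/andP[BV /no_edgeP HB] dBA].
have vB : v \notin B by apply/negP => /(fintype.subsetP BV); rewrite !inE eqxx.
have BA x : x \in B -> x \notin A.
  move=> xB; apply/negP => xA; have := disjointFr dBA xB.
  rewrite !inE xA !andbT /=; case: (eqVneq x v) => [e|//].
  by rewrite -e xB in vB.
have BV' : B \subset V.
  by apply: fintype.subset_trans BV _; apply: subD1set.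
apply/andP; split; first (apply/andP; split=> //).
- apply/no_edgeP => x y xB; rewrite inE => /andP[yB yV].
  case: (eqVneq y v) => [->|yv]; last by apply: HB; rewrite // !inE yB yv.
  rewrite adjC; apply/negP => vx; have := disjointFr dBA xB.
  by rewrite !inE vx (BA _ xB) (fintype.subsetP BV') // orbT.
- apply/pred0P => x /=; apply/negP => /andP[xB xA].
  by move: (BA x xB); rewrite xA.
Qed.

Lemma component_eq G V B C v :
  component G V B -> component G V C -> v \in B -> v \in C -> B = C.
Proof.
have sub B1 B2 : component G V B1 -> component G V B2 -> v \in B1 -> v \in B2 ->
    B1 \subset B2.
  move=> /and4P[_ BV _ /forallP/(_ (B1 :&: B2))/implyP H].
  move=> /and4P[_ _ /no_edgeP HC _] vB vC.
  suff /H/eqP <- : [&& B1 :&: B2 != set0, B1 :&: B2 \subset B1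
                 & no_edge G (B1 :&: B2) (B1 :\: (B1 :&: B2))] by apply: subsetIr.
  rewrite subsetIl /=; apply/andP; split.
    by apply/set0Pn; exists v; rewrite inE vB.
  apply/no_edgeP => x y; rewrite !inE => /andP[xB xC] /andP[].
  move=> yBC yB; rewrite yB /= in yBC.
  by apply: HC; rewrite // inE yBC (fintype.subsetP BV).
move=> HB HC vB vC; apply/eqP; rewrite finset.eqEsubset.
by rewrite !(sub B C, sub C B).
Qed.

(** The component of [v] is a smallest set that contains [v] and has no edge to
    its complement in [V].  If it could be split into [S] and [B :\: S], the
    half that contains [v] would be a smaller such set. *)
Lemma component_exists G V v : v \in V ->
  exists2 B, component G V B & v \in B.
Proof.
move=> vV; pose Q B := [&& v \in B, B \subset V & no_edge G B (V :\: B)].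
have QV : Q V.
  by rewrite /Q vV fintype.subxx setDv; apply/no_edgeP => x y _; rewrite inE.
have [B /minsetP[/and3P[vB BV /no_edgeP HB] minB] _] := minset_exists QV.
exists B => //; apply/and4P; split=> //; first by apply/set0Pn; exists v.
  exact/no_edgeP.
apply/forallP => S; apply/implyP => /and3P[S0 SB /no_edgeP HS].
case: (boolP (v \in S)) => vS.
  apply/eqP/minB => //; rewrite /Q vS (fintype.subset_trans SB BV) /=.
  apply/no_edgeP => x y xS; rewrite inE => /andP[yS yV].
  have [yB|yB] := boolP (y \in B); first by apply: HS; rewrite // inE yS.
  by apply: HB; rewrite ?inE ?yB // (fintype.subsetP SB).
have : B :\: S = B.
  apply/minB; last exact: subsetDl.
  rewrite /Q inE vS vB (fintype.subset_trans (subsetDl _ _) BV) /=.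
  apply/no_edgeP => x y; rewrite !inE => /andP[xS xB] /andP[].
  have [yB|yB] := boolP (y \in B); last by move=> _ yV; apply: HB; rewrite // inE yB.
  rewrite andbT negbK => yS _; rewrite adjC; apply: HS => //.
  by rewrite inE xS.
move=> e; case/set0Pn: S0 => x xS; move: (fintype.subsetP SB _ xS).
by rewrite -e inE xS.
Qed.

Lemma disjoint_set0 B : [disjoint B & set0].
Proof. by apply/pred0P => x /=; rewrite inE andbF. Qed.

(** Exactly one component contains [v]. *)
Lemma ncomp_avoiding0 G V v : v \in V ->
  ncomp_avoiding G V set0 = (ncomp_avoiding G V [set v]).+1.
Proof.
move=> vV; have [B HB vB] := component_exists G vV.
rewrite /ncomp_avoiding (cardsD1 B) !inE HB disjoint_set0 /= add1n.
congr _.+1; apply: eq_card => C; rewrite !inE.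
rewrite disjoint_set0 andbT disjoint_sym disjoints1.
have [HC|_] := boolP (component G V C); rewrite ?(andbT, andbF) //.
apply/idP/idP => [CB|].
  by apply: contra CB => vC; rewrite (component_eq HC HB vC vB).
by apply: contraNneq => ->.
Qed.

(** The classes of the reachability relation are the components: a class has no
    proper part without outgoing edges, and every component meets a class. *)
Lemma ncomponentsE G : ncomponents G = ncomp_avoiding G setT set0.
Proof.
have sym : connect_sym (adj G).
  by apply: sym_connect_sym => x y; apply: adjC.
pose cl x := [set y | connect (adj G) x y].
have clC x : component G setT (cl x).
  apply/and4P; split.
  - by apply/set0Pn; exists x; rewrite inE connect0.
  - exact: subsetT.
  - apply/no_edgeP => y z; rewrite !inE andbT => xy; apply: contra => yz.
    exact: connect_trans xy (connect1 yz).
  - apply/forallP => S; apply/implyP => /and3P[/set0Pn[y yS] Sx /no_edgeP HS].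
    have xy : connect (adj G) x y by move: (fintype.subsetP Sx _ yS); rewrite inE.
    rewrite finset.eqEsubset Sx; apply/fintype.subsetP => z; rewrite inE => xz.
    have yz : connect (adj G) y z by apply: connect_trans xz; rewrite sym.
    have clS : fingraph.closed (adj G) (mem S).
      apply: (intro_closed sym) => a b ab aS; have {}aS : a \in S := aS.
      rewrite -topredE /=.
      have xa : connect (adj G) x a by move: (fintype.subsetP Sx _ aS); rewrite inE.
      apply: contraT => bS; have := HS a b aS.
      by rewrite !inE bS (connect_trans xa (connect1 ab)) ab => /(_ isT).
    by rewrite -(fingraph.closed_connect clS yz).
rewrite /ncomponents /ncomp_avoiding.
transitivity #|[set cl x | x in [pred x | roots (adj G) x]]|.
  rewrite card_in_imset.
    by apply: eq_card => x; rewrite !inE andbT.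
  move=> x y; rewrite !inE => /eqP rx /eqP ry /setP/(_ y).
  by rewrite !inE connect0 => /(fingraph.rootP sym); rewrite rx ry.
apply: eq_card => B; rewrite !inE disjoint_set0 andbT.
apply/imsetP/idP => [[x _ ->]|HB]; first exact: clC.
have /set0Pn[x xB] : B != set0 by case/andP: HB.
exists (fingraph.root (adj G) x); first by rewrite inE roots_root.
apply: (component_eq HB (clC _) xB); rewrite inE sym; exact: connect_root.
Qed.

End Components.

(** * Exposing the edges at one vertex *)

Section Expectation.
Local Open Scope set_scope.
Variables (R : realType) (n : nat) (p : R).
Local Notation K := (Kedges n).

(** Expectation of a vector-valued variable; it is applied to polynomials in
    order to treat all factorial moments at once. *)
Definition Gnp_mean (V : lmodType R) (h : {set {set 'I_n}} -> V) : V :=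
  \sum_(G in powerset K) Gnp_weight p G *: h G.

Lemma sum_powerset_edge (V : lmodType R) (e : {set 'I_n}) (f : {set {set 'I_n}} -> V) :
  e \in K ->
  \sum_(G in powerset K) f G =
  \sum_(G in powerset K | e \notin G) (f G + f (e |: G)).
Proof.
move=> eK; rewrite (bigID (fun G : {set {set 'I_n}} => e \notin G)) /= big_split /=.
congr (_ + _).
rewrite (reindex_onto (fun G => e |: G) (fun G => G :\ e)) /=; last first.
  by move=> G /andP[_]; rewrite negbK => /setD1K.
apply: eq_bigl => G; rewrite !powersetE !inE eqxx subUset sub1set eK /= andbT.
case: (boolP (e \in G)) => eG; last by rewrite setU1K ?eqxx ?andbT.
rewrite andbF; apply/negP => /andP[_ /eqP GE]; move: eG.
by rewrite -GE !inE eqxx.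
Qed.

(** Conditioning on the presence of the edge [e]. *)
Lemma Gnp_mean_edge (V : lmodType R) (e : {set 'I_n}) (h : {set {set 'I_n}} -> V) :
  e \in K ->
  Gnp_mean h = p *: Gnp_mean (fun G => h (e |: G))
             + (1 - p) *: Gnp_mean (fun G => h (G :\ e)).
Proof.
move=> eK.
pose W (G : {set {set 'I_n}}) := \prod_(x in K | x != e) (if x \in G then p else 1 - p).
have wN (G : {set {set 'I_n}}) : e \notin G -> Gnp_weight p G = (1 - p) * W G.
  by move=> eG; rewrite /Gnp_weight (bigD1 e) //= (negbTE eG).
have wU (G : {set {set 'I_n}}) : Gnp_weight p (e |: G) = p * W G.
  rewrite /Gnp_weight (bigD1 e) //= setU11; congr (_ * _).
  by apply: eq_bigr => x /andP[_ xe]; rewrite !inE (negbTE xe).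
rewrite /Gnp_mean !(sum_powerset_edge _ eK) !scaler_sumr -big_split /=.
apply: eq_bigr => G /andP[_ eG].
rewrite !wU !(wN _ eG) setUA setUid setU1K //.
have -> : G :\ e = G.
  by apply/setP => x; rewrite !inE; case: eqVneq => // ->; rewrite (negbTE eG).
rewrite -!scalerDl !scalerA [LHS]addrC subrK !scale1r //.
Qed.

Lemma eq_Gnp_mean (V : lmodType R) (h1 h2 : {set {set 'I_n}} -> V) :
  (forall G : {set {set 'I_n}}, G \subset K -> h1 G = h2 G) -> Gnp_mean h1 = Gnp_mean h2.
Proof.
by move=> E; apply: eq_bigr => G; rewrite powersetE => GK; rewrite E.
Qed.

End Expectation.

Section BinomialMean.
Variables (R : comNzRingType) (p : R) (V : lmodType R).

(** The expectation of [phi j] for a binomial variable j of parameters m, p. *)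
Definition binom_mean m (phi : nat -> V) : V :=
  \sum_(j < m.+1) ('C(m, j)%:R * p ^+ j * (1 - p) ^+ (m - j)) *: phi j.

Lemma binom_mean0 phi : binom_mean 0 phi = phi 0%N.
Proof. by rewrite /binom_mean big_ord1 bin0 !expr0 !mul1r scale1r. Qed.

Lemma binom_meanS m phi :
  binom_mean m.+1 phi
  = p *: binom_mean m (fun j => phi j.+1) + (1 - p) *: binom_mean m phi.
Proof.
rewrite /binom_mean !scaler_sumr.
rewrite big_ord_recl /= [in X in _ = _ + X]big_ord_recl /= /bump /=.
rewrite addrCA; congr (_ + _).
  by rewrite scalerA !bin0 !subn0 exprS; congr (_ *: _); ring.
under eq_bigr => i _ do rewrite add1n binS natrD !mulrDl scalerDl.
rewrite big_split /= addrC; congr (_ + _).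
  apply: eq_bigr => i _; rewrite scalerA subSS exprS; congr (_ *: _); ring.
rewrite big_ord_recr /= bin_small // !mul0r scale0r addr0.
apply: eq_bigr => i _; rewrite scalerA !add1n; congr (_ *: _).
have -> : (m.+1 - i.+1 = (m - i.+1).+1)%N by have := ltn_ord i; lia.
by rewrite !exprS; ring.
Qed.

Lemma eq_binom_mean m phi psi : (forall j, (j <= m)%N -> phi j = psi j) ->
  binom_mean m phi = binom_mean m psi.
Proof. by move=> E; apply: eq_bigr => j _; rewrite E // -ltnS. Qed.

End BinomialMean.

Section Expose.
Local Open Scope set_scope.
Variables (R : realType) (n : nat) (p : R).
Variable (V : lmodType R).
Implicit Types (G : {set {set 'I_n}}) (U J : {set 'I_n}) (v : 'I_n).

Definition nbrs G v U := [set u in U | adj G v u].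

(** The neighbours of [v] in [U] are independent of the edges inside the rest of
    the graph, on which [g J] depends, and their number is binomial.  The edges
    from [v] to [U] are exposed one by one, Pascal's rule [binom_meanS] collecting
    the outcomes; this is possible since the mean of [g J] depends on the size of
    [J] only. *)
Lemma mean_nbrs v U (g : {set 'I_n} -> {set {set 'I_n}} -> V) (phi : nat -> V) :
  v \notin U ->
  (forall J G u, u \in U -> g J ([set v; u] |: G) = g J G) ->
  (forall J G u, u \in U -> g J (G :\ [set v; u]) = g J G) ->
  (forall J, J \subset U -> Gnp_mean p (g J) = phi #|J|) ->
  Gnp_mean p (fun G => g (nbrs G v U) G) = binom_mean p #|U| phi.
Proof.
move: {2}#|U| (erefl #|U|) => m; elim: m U g phi => [|m IH] U g phi cU vU gU gD gE.
  rewrite cU binom_mean0; have U0 := cards0_eq cU.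
  rewrite -[0%N](@cards0 'I_n) -gE ?sub0set //; apply: eq_Gnp_mean => G _.
  by congr (g _ G); apply/setP => x; rewrite U0 !inE.
have /set0Pn[u uU] : U != set0 by rewrite -card_gt0 cU.
have cU' : #|U :\ u| = m by move: cU; rewrite (cardsD1 u) uU; lia.
have uv : u != v by apply: contraNneq vU => <-.
have eK : [set v; u] \in Kedges n by rewrite inE cards2 [v == u]eq_sym uv.
have vU' : v \notin U :\ u by rewrite !inE negb_and vU orbT.
have ne x : x \in U -> x != u -> ([set v; x] == [set v; u]) = false.
  move=> xU xu; apply/negP => /eqP/setP/(_ x); rewrite !inE eqxx (negbTE xu) orbT orbF.
  by move=> /esym/eqP xv; rewrite xv (negbTE vU) in xU.
rewrite (Gnp_mean_edge p _ eK) cU binom_meanS; congr (_ *: _ + _ *: _).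
- rewrite -cU' -(IH (U :\ u) (fun J => g (u |: J)) (fun j => phi j.+1)) //.
  + apply: eq_Gnp_mean => G _; rewrite gU //; congr (g _ G).
    apply/setP => x; rewrite !inE; case: (eqVneq x u) => [->|xu] /=.
      by rewrite uU /adj !inE eqxx.
    by have [xU|//] := boolP (x \in U); rewrite /adj !inE (ne x xU xu).
  + by move=> J G x; rewrite !inE => /andP[_ xU]; apply: gU.
  + by move=> J G x; rewrite !inE => /andP[_ xU]; apply: gD.
  + move=> J JU; have uJ : u \notin J.
      by apply/negP => /(subsetP JU); rewrite !inE eqxx.
    rewrite gE; last by rewrite subUset sub1set uU (subset_trans JU) // subD1set.
    by rewrite cardsU1 uJ.
- rewrite -cU' -(IH (U :\ u) g phi) //.
  + apply: eq_Gnp_mean => G _; rewrite gD //; congr (g _ G).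
    apply/setP => x; rewrite !inE; case: (eqVneq x u) => [->|xu] /=.
      by rewrite uU /adj !inE eqxx.
    by have [xU|//] := boolP (x \in U); rewrite /adj !inE (ne x xU xu).
  + by move=> J G x; rewrite !inE => /andP[_ xU]; apply: gU.
  + by move=> J G x; rewrite !inE => /andP[_ xU]; apply: gD.
  + by move=> J JU; apply: gE; apply: subset_trans JU _; apply: subD1set.
Qed.
End Expose.

(** * The generating function of the number of components *)

Section GeneratingFunction.
Variables (R : comNzRingType) (p : R).

(** The expectation of z^X, where X is the number of components that avoid a
    roots in a random graph on the roots and m further vertices.  If there are
    roots, one of them is exposed; otherwise an arbitrary vertex is made a root,
    which removes one component from the count and gives the factor 'X.  The
    number t of vertices bounds the depth of the recursion. *)
Fixpoint compgf_rec t a m : {poly R} :=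
  if t is t'.+1 then
    match a, m with
    | a'.+1, _ => binom_mean p m (fun j => compgf_rec t' (a' + j)%N (m - j)%N)
    | 0, m'.+1 =>
        'X * binom_mean p m' (fun j => compgf_rec t' j (m' - j)%N)
    | 0, 0 => 1
    end
  else 1.

Definition compgf a m := compgf_rec (a + m)%N a m.

Lemma compgf00 : compgf 0 0 = 1. Proof. by []. Qed.

Lemma compgfS a m :
  compgf a.+1 m = binom_mean p m (fun j => compgf (a + j)%N (m - j)%N).
Proof.
rewrite {1}/compgf addSn /=; apply: eq_binom_mean => j jm.
by rewrite /compgf; congr compgf_rec; lia.
Qed.

Lemma compgf0S m : compgf 0 m.+1 = 'X * compgf 1 m.
Proof.
rewrite compgfS {1}/compgf add0n /=; congr (_ * _); apply: eq_binom_mean => j jm.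
by rewrite /compgf; congr compgf_rec; lia.
Qed.

End GeneratingFunction.

Section MeanGF.
Local Open Scope set_scope.
Variables (R : realType) (n : nat) (p : R).
Implicit Types (G : {set {set 'I_n}}) (V A W : {set 'I_n}) (v : 'I_n).

Lemma Gnp_weight_sum : \sum_(G in powerset (Kedges n)) Gnp_weight p G = 1.
Proof.
pose f e : R := if e \in Kedges n then p else 0.
pose g e : R := if e \in Kedges n then 1 - p else 1.
have := @bigA_distr R 0 1 *%R +%R _ f g.
rewrite big1 => [->|e _]; last first.
  by rewrite /f /g; case: ifP => _; [exact: subrKC | exact: add0r].
rewrite [RHS](bigID (fun G => G \in powerset (Kedges n))) /= [X in _ = _ + X]big1 ?addr0.
  apply: eq_bigr => G; rewrite powersetE => GK; rewrite /Gnp_weight.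
  rewrite [RHS](bigID (fun e => e \in Kedges n)) /= [X in _ * X]big1 ?mulr1.
    by apply: eq_bigr => e eK; rewrite /f /g eK.
  move=> e eK; rewrite /g (negbTE eK); case: ifP => // eG.
  by rewrite (subsetP GK _ eG) in eK.
move=> G; rewrite powersetE => /subsetPn[e eG eK].
by rewrite (bigD1 e) //= eG /f (negbTE eK) mul0r.
Qed.

Lemma eq_no_edge G G' (B C : {set 'I_n}) :
  {in B & C, forall x y, adj G x y = adj G' x y} ->
  no_edge G B C = no_edge G' B C.
Proof.
move=> E; apply: eq_forallb_in => x xB; apply: eq_forallb_in => y yC.
by rewrite E.
Qed.

(** The count depends only on the edges inside [W]; hence it is not affected by
    the edges at a vertex outside [W]. *)
Lemma eq_ncomp_avoiding G (G' : {set {set 'I_n}}) W A :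
  {in W &, forall x y, adj G x y = adj G' x y} ->
  ncomp_avoiding G W A = ncomp_avoiding G' W A.
Proof.
move=> E; apply: eq_card => B; rewrite !inE; congr (_ && _).
rewrite /component; have [_|//] := boolP (B != set0).
have [BW|//] := boolP (B \subset W); congr [&& _, _, _ & _].
  apply: eq_no_edge => x y xB; rewrite inE => /andP[_ yW].
  by rewrite E // (subsetP BW).
apply: eq_forallb => S; congr (_ ==> _); have [_|//] := boolP (S != set0).
have [SB|//] := boolP (S \subset B); rewrite /=.
apply: eq_no_edge => x y xS; rewrite inE => /andP[_ yB].
by rewrite E // (subsetP BW) // (subsetP SB).
Qed.

(** Both sides satisfy the exploration recursion.  Induction on the number of
    vertices. *)
Lemma mean_compgf V A : A \subset V ->
  Gnp_mean p (fun G => 'X^(ncomp_avoiding G V A)) = compgf p #|A| #|V :\: A|.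
Proof.
move: {2}#|V| (erefl #|V|) => t; elim: t V A => [|t IH] V A cV AV.
  have V0 := cards0_eq cV; move: AV; rewrite V0 subset0 => /eqP ->.
  rewrite setD0 cards0 compgf00 -[RHS]scale1r -Gnp_weight_sum scaler_suml.
  apply: eq_bigr => G _; congr (_ *: _).
  rewrite /ncomp_avoiding (_ : [set _ | _] = set0) ?cards0 ?expr0 //.
  apply/setP => B; rewrite !inE; apply/negP => /andP[/and4P[/negP]].
  by rewrite -subset0.
(* With at least one root: expose the root v. *)
have pos A' v : A' \subset V -> v \in A' ->
    Gnp_mean p (fun G => 'X^(ncomp_avoiding G V A'))
    = compgf p #|A'| #|V :\: A'|.
  move=> A'V vA; have vV := subsetP A'V _ vA.
  have cA : #|A'| = #|A' :\ v|.+1 by rewrite (cardsD1 v) vA.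
  have cW : #|V :\ v| = t by apply: succn_inj; rewrite -cV [RHS](cardsD1 v) vV.
  rewrite cA compgfS -(@mean_nbrs _ _ _ _ v _
      (fun J G => 'X^(ncomp_avoiding G (V :\ v) (A' :\ v :|: J)))).
  - by apply: eq_Gnp_mean => G _; rewrite (@ncomp_avoiding_expose _ _ _ _ v).
  - by rewrite inE vA.
  - move=> J G u _; congr ('X^_); apply: eq_ncomp_avoiding => x y.
    rewrite !inE => /andP[xv _] /andP[yv _]; rewrite /adj !inE.
    case: eqP => // /setP/(_ v).
    by rewrite !inE eqxx eq_sym (negbTE xv) eq_sym (negbTE yv).
  - move=> J G u _; congr ('X^_); apply: eq_ncomp_avoiding => x y.
    rewrite !inE => /andP[xv _] /andP[yv _]; rewrite /adj !inE.
    case: eqP => // /setP/(_ v).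
    by rewrite !inE eqxx eq_sym (negbTE xv) eq_sym (negbTE yv).
  - move=> J JU.
    have dJ : [disjoint A' :\ v & J].
      apply/pred0P => x /=; rewrite !inE; apply/negP => /andP[/andP[_ xA] /(subsetP JU)].
      by rewrite inE xA.
    rewrite IH //; last first.
      rewrite subUset setSD //; apply: subset_trans JU _.
      by rewrite setDS // sub1set.
    congr compgf; first by rewrite cardsU disjoint_setI0 // cards0 subn0.
    rewrite -cardsDS; last exact: JU.
    apply: eq_card => x; rewrite !inE.
    by case: (eqVneq x v) => [->|_] /=; rewrite ?vA ?andbF // negb_or andbCA andbA.
have [A0|/set0Pn[v vA]] := eqVneq A set0; last exact: (pos A v).
(* Without roots: an arbitrary vertex v becomes the only root. *)
have /set0Pn[v vV] : V != set0 by rewrite -card_gt0 cV.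
rewrite A0 setD0 cards0 (cardsD1 v) vV compgf0S -[in RHS](cards1 v) -(pos _ v).
- rewrite /Gnp_mean mulr_sumr; apply: eq_bigr => G _.
  by rewrite (ncomp_avoiding0 _ vV) exprS scalerAr.
- by rewrite sub1set.
- by rewrite inE.
Qed.

End MeanGF.

(** * Identities obtained by splitting off one component *)

Section Triangular.
Variable V : nmodType.
Implicit Type F : nat -> nat -> V.

Lemma sum_triangleC m F :
  \sum_(j < m.+1) \sum_(k < (m - j).+1) F j k
  = \sum_(k < m.+1) \sum_(j < (m - k).+1) F j k.
Proof.
have E F' : \sum_(j < m.+1) \sum_(k < (m - j).+1) F' j k
    = \sum_(j < m.+1) \sum_(k < m.+1 | (j + k <= m)%N) F' j k.
  apply: eq_bigr => j _.
  rewrite (big_ord_widen m.+1); last by rewrite ltnS leq_subr.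
  by apply: eq_bigl => k; have := ltn_ord j; lia.
rewrite E (E (fun k j => F j k)) (exchange_big_dep predT) //=.
by apply: eq_bigr => k _; apply: eq_bigl => j; rewrite addnC.
Qed.

Lemma sum_triangle_diag m F :
  \sum_(j < m.+1) \sum_(k < (m - j).+1) F j k
  = \sum_(l < m.+1) \sum_(j < l.+1) F j (l - j)%N.
Proof.
transitivity (\sum_(j < m.+1) \sum_(l < m.+1 | (j <= l)%N) F j (l - j)%N).
  apply: eq_bigr => j _.
  rewrite -(big_mkord xpredT (fun k => F j k)).
  rewrite -(big_mkord (fun l => j <= l)%N (fun l => F j (l - j)%N)).
  have jm := ltn_ord j.
  rewrite [RHS](big_cat_nat (n := j)) ?leq0n //=; last exact: ltnW.
  rewrite [X in _ = X + _]big_nat_cond [X in _ = X + _]big1 ?add0r; last first.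
    by move=> l; lia.
  rewrite (_ : \sum_(j <= l < m.+1 | (j <= l)%N) _
             = \sum_(0 + j <= l < m.+1 | (j <= l)%N) F j (l - j)%N) //.
  rewrite big_addn subSn -1?ltnS //.
  rewrite big_nat_cond [RHS]big_nat_cond; apply: eq_big => k; first by lia.
  by move=> _; rewrite addnK.
rewrite (exchange_big_dep predT) //=; apply: eq_bigr => l _.
rewrite (big_ord_widen m.+1 (fun j => F j (l - j)%N)) //.
Qed.

End Triangular.

Lemma bin_fact3 m j k : (j + k <= m)%N ->
  ('C(m, j) * 'C(m - j, k) * (j`! * k`! * (m - j - k)`!) = m`!)%N.
Proof.
move=> jk; rewrite -(@bin_fact m j); last by lia.
rewrite -(@bin_fact (m - j) k); last by lia.
by lia.
Qed.

(** Disjoint subsets of sizes j and k may be chosen in either order. *)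
Lemma mul_binC m j k : (j + k <= m)%N ->
  ('C(m, j) * 'C(m - j, k) = 'C(m, k) * 'C(m - k, j))%N.
Proof.
move=> jk; apply/eqP.
have gt0 : (0 < j`! * k`! * (m - j - k)`!)%N by rewrite !muln_gt0 !fact_gt0.
rewrite -(eqn_pmul2r gt0) bin_fact3 //.
rewrite [(j`! * _)%N]mulnC subnAC bin_fact3 // addnC //.
Qed.

(** A set of size l together with a subset of size j of it may be chosen in
    either order. *)
Lemma mul_bin_subset m j l : (j <= l)%N -> (l <= m)%N ->
  ('C(m, j) * 'C(m - j, l - j) = 'C(m, l) * 'C(l, j))%N.
Proof.
move=> jl lm; apply/eqP.
have gt0 : (0 < j`! * (l - j)`! * (m - j - (l - j))`!)%N.
  by rewrite !muln_gt0 !fact_gt0.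
rewrite -(eqn_pmul2r gt0) bin_fact3; last by lia.
have -> : (m - j - (l - j) = m - l)%N by lia.
by apply/eqP; rewrite -(bin_fact lm) -(bin_fact jl); lia.
Qed.

Section Identities.
Variables (R : comNzRingType) (p : R).
Local Notation q := (1 - p).
Local Notation P := (compgf p).

Lemma horner_binom_mean m (phi : nat -> {poly R}) x :
  (binom_mean p m phi).[x]
  = \sum_(j < m.+1) 'C(m, j)%:R * p ^+ j * q ^+ (m - j) * (phi j).[x].
Proof. by rewrite horner_sum; apply: eq_bigr => j _; rewrite hornerZ. Qed.

(** Decomposition according to the number k of vertices that are joined to the
    roots: no edge leaves the a + k vertices thus reached, and what remains is a
    random graph without roots.  Both sides satisfy the exploration recursion,
    so the identity follows by induction on the number of vertices. *)
Lemma compgf_root_closure a m :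
  P a m = \sum_(k < m.+1)
    ('C(m, k)%:R * (P a k).[0] * q ^+ ((a + k) * (m - k))) *: P 0 (m - k)%N.
Proof.
move: {2}(a + m)%N (erefl (a + m)%N) => t.
elim: t a m => [|t IH] [|a] m e; try by [].
- by move: e; rewrite add0n => ->; rewrite big_ord1 compgf00 hornerC mulr1 mul1r scale1r.
- rewrite big_ord_recl bin0 compgf00 hornerC !mul1r mul0n expr0 scale1r subn0.
  rewrite big1 ?addr0 // => k _.
  by rewrite compgf0S hornerM hornerX !(mul0r, mulr0) scale0r.
rewrite compgfS /binom_mean.
pose F j k : {poly R} :=
  ('C(m, j)%:R * p ^+ j * q ^+ (m - j) *
   ('C(m - j, k)%:R * (P (a + j)%N k).[0] * q ^+ ((a + j + k) * (m - j - k))))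
  *: P 0 (m - j - k)%N.
transitivity (\sum_(j < m.+1) \sum_(k < (m - j).+1) F j k).
  apply: eq_bigr => j _; rewrite IH; last by have := ltn_ord j; lia.
  by rewrite scaler_sumr; apply: eq_bigr => k _; rewrite scalerA.
rewrite sum_triangle_diag; apply: eq_bigr => l _.
have lm : (l <= m)%N by rewrite -ltnS.
rewrite compgfS horner_binom_mean mulr_sumr mulr_suml scaler_suml.
apply: eq_bigr => j _; rewrite /F.
have jl : (j <= l)%N by rewrite -ltnS.
have -> : (m - j - (l - j) = m - l)%N by lia.
congr (_ *: _).
have -> : (a + j + (l - j) = a + l)%N by lia.
have -> : (m - j = (m - l) + (l - j))%N by lia.
have -> : ((a.+1 + l) * (m - l) = (a + l) * (m - l) + (m - l))%N by lia.
have -> : 'C(m, l)%:R * ('C(l, j)%:R * p ^+ j * q ^+ (l - j)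
      * (P (a + j)%N (l - j)%N).[0])
  = ('C(m, l) * 'C(l, j))%:R * p ^+ j * q ^+ (l - j)
      * (P (a + j)%N (l - j)%N).[0] :> R.
  by rewrite natrM; ring.
rewrite -mul_bin_subset // natrM.
have -> : (m - j = (m - l) + (l - j))%N by lia.
by rewrite !exprD; ring.
Qed.

(** The probability that G(k,p) is connected: with one vertex as root, no
    component avoids the root.  A component is nonempty, whence the value 0 at
    k = 0. *)
Definition conn_prob k : R := if k is k'.+1 then (P 1 k').[0] else 0.

(** The derivative of z^X marks one of the X components that avoid the roots; if
    it has k vertices, it is connected, has no edge to the a + m - k other
    vertices, and the rest is again a random graph with a roots. *)
Lemma deriv_compgf a m :
  (P a m)^`() = \sum_(k < m.+1)
    ('C(m, k)%:R * conn_prob k * q ^+ (k * (a + m - k))) *: P a (m - k)%N.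
Proof.
move: {2}(a + m)%N (erefl (a + m)%N) => t.
elim: t a m => [|t IH] a m e.
  have [-> ->] : a = 0%N /\ m = 0%N by lia.
  by rewrite compgf00 derivC big_ord1 /= mulr0 mul0r scale0r.
(* With at least one root both sides satisfy the exploration recursion. *)
have posa b m' : (b + m' = t)%N -> (P b.+1 m')^`() = \sum_(k < m'.+1)
    ('C(m', k)%:R * conn_prob k * q ^+ (k * (b.+1 + m' - k))) *: P b.+1 (m' - k)%N.
  move=> bm; rewrite compgfS /binom_mean raddf_sum /=.
  pose F j k : {poly R} :=
    ('C(m', j)%:R * p ^+ j * q ^+ (m' - j) *
     ('C(m' - j, k)%:R * conn_prob k * q ^+ (k * (b + m' - k))))
    *: P (b + j)%N (m' - j - k)%N.
  transitivity (\sum_(j < m'.+1) \sum_(k < (m' - j).+1) F j k).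
    apply: eq_bigr => j _; have jm := ltn_ord j.
    rewrite derivZ IH; last by lia.
    rewrite scaler_sumr; apply: eq_bigr => k _; rewrite scalerA /F.
    by have -> : (b + j + (m' - j) - k = b + m' - k)%N by lia.
  rewrite sum_triangleC; apply: eq_bigr => k _; have km := ltn_ord k.
  rewrite compgfS /binom_mean scaler_sumr; apply: eq_bigr => j _.
  have jk := ltn_ord j.
  rewrite /F scalerA subnAC; congr (_ *: _).
  have -> : 'C(m', j)%:R * p ^+ j * q ^+ (m' - j) *
     ('C(m' - j, k)%:R * conn_prob k * q ^+ (k * (b + m' - k)))
   = ('C(m', j) * 'C(m' - j, k))%:R * p ^+ j * conn_prob k *
     (q ^+ (m' - j) * q ^+ (k * (b + m' - k))) :> R by rewrite natrM; ring.
  rewrite mul_binC; last by lia.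
  rewrite -exprD.
  have -> : (m' - j + k * (b + m' - k) = k * (b.+1 + m' - k) + (m' - k - j))%N.
    have -> : (b.+1 + m' - k = (b + m' - k).+1)%N by lia.
    by rewrite mulnS; lia.
  by rewrite natrM exprD; ring.
case: a e => [|a] e; last by apply: posa; lia.
case: m e => [//|m] e.
(* Without roots, Pascal's rule separates the two cases: the marked component
   contains the vertex that is made a root, or it does not. *)
rewrite compgf0S derivM derivX mul1r (posa 0%N m); last by lia.
rewrite mulr_sumr.
rewrite [RHS]big_ord_recl /= mulr0 mul0r scale0r add0r.
under [RHS]eq_bigr => k _ do rewrite /bump /= add1n binS natrD !mulrDl scalerDl.
rewrite big_split /= [LHS]addrC; congr (_ + _); last first.
  rewrite compgf_root_closure; apply: eq_bigr => k _.
  by rewrite !add0n !subSS !add1n.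
rewrite [RHS]big_ord_recr /= bin_small // !mul0r scale0r addr0.
rewrite big_ord_recl /= mulr0 mul0r scale0r mulr0 add0r.
apply: eq_bigr => k _; rewrite /bump /= !add1n add0n !subSS.
have -> : (m - k = (m - k.+1).+1)%N by have := ltn_ord k; lia.
by rewrite compgf0S scalerAr.
Qed.

End Identities.

(** * Connection probabilities and Cayley's formula *)

(** Cayley's number a (a+m)^(m-1) of forests on a + m vertices in which a given
    vertices lie in distinct trees. *)
Definition nforests a m : nat := if m is m'.+1 then (a * (a + m) ^ m')%N else 1%N.

Lemma nforestsM a m : ((a + m) * nforests a m = a * (a + m) ^ m)%N.
Proof. by case: m => [|m] /=; rewrite ?addn0 ?muln1 // expnS mulnCA. Qed.

Lemma sum_bin_weighted m N :
  (\sum_(j < m.+1) 'C(m, j) * (j * N ^ (m - j)) = m * N.+1 ^ m.-1)%N.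
Proof.
case: m => [|m]; first by rewrite big_ord1.
rewrite big_ord_recl mul0n muln0 add0n /= -(addn1 N) expnDn big_distrr /=.
apply: eq_bigr => j _; rewrite /bump /= add1n subSS exp1n muln1.
by rewrite mulnCA !mulnA -mul_bin_diag.
Qed.

(** The forest numbers satisfy the exploration recursion without the factors
    q: the j neighbours of one root become roots.  After multiplication by the
    number N = a + m of remaining vertices both parts of the sum are instances
    of the binomial theorem. *)
Lemma nforests_expose a m :
  (\sum_(j < m.+1) 'C(m, j) * nforests (a + j) (m - j) = nforests a.+1 m)%N.
Proof.
case: m => [|m]; first by rewrite big_ord1.
set N := (a + m.+1)%N.
have N0 : (0 < N)%N by rewrite /N; lia.
apply/eqP; rewrite -(eqn_pmul2l N0) big_distrr /=.
under eq_bigr => j _.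
  rewrite mulnCA.
  have -> : N = (a + j + (m.+1 - j))%N by have := ltn_ord j; lia.
  rewrite nforestsM.
  have -> : (a + j + (m.+1 - j))%N = N by have := ltn_ord j; lia.
  rewrite mulnDl mulnDr.
over.
rewrite big_split /= sum_bin_weighted /=.
have -> : (\sum_(j < m.+2) 'C(m.+1, j) * (a * N ^ (m.+1 - j)) = a * N.+1 ^ m.+1)%N.
  rewrite -(addn1 N) expnDn big_distrr /=; apply: eq_bigr => j _.
  by rewrite exp1n muln1 mulnCA.
rewrite addSn -/N expnS; apply/eqP; rewrite /N; lia.
Qed.

Section ConnBounds.
Variables (R : realFieldType) (p : R).
Hypothesis p01 : 0 <= p <= 1.
Local Notation q := (1 - p).
Local Notation P := (compgf p).

Let p0 : 0 <= p. Proof. by case/andP: p01. Qed.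
Let q0 : 0 <= q. Proof. by case/andP: p01 => _; rewrite subr_ge0. Qed.
Let q1 : q <= 1. Proof. by rewrite gerBl. Qed.

Lemma compgf_coef_ge0 a m i : 0 <= (P a m)`_i.
Proof.
move: {2}(a + m)%N (erefl (a + m)%N) => t.
elim: t a m i => [|t IH] a m i e.
  have [-> ->] : a = 0%N /\ m = 0%N by lia.
  by rewrite compgf00 coefC; case: ifP.
have posa b m' k : (b + m' = t)%N -> 0 <= (P b.+1 m')`_k.
  move=> bm; rewrite compgfS coef_sum; apply: sumr_ge0 => j _.
  rewrite coefZ mulr_ge0 //; first by rewrite !mulr_ge0 ?exprn_ge0.
  by apply: IH; have := ltn_ord j; lia.
case: a e => [|a] e; last by apply: posa; lia.
case: m e => [//|m] e; rewrite compgf0S coefXM; case: ifP => // _.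
by apply: posa; lia.
Qed.

(** The total probability. *)
Lemma compgf_at1 a m : (P a m).[1] = 1.
Proof.
move: {2}(a + m)%N (erefl (a + m)%N) => t.
elim: t a m => [|t IH] a m e.
  have [-> ->] : a = 0%N /\ m = 0%N by lia.
  by rewrite compgf00 hornerC.
have posa b m' : (b + m' = t)%N -> (P b.+1 m').[1] = 1.
  move=> bm; rewrite compgfS horner_binom_mean.
  transitivity ((q + p) ^+ m'); last by rewrite subrK expr1n.
  rewrite exprDn; apply: eq_bigr => j _; rewrite IH; last by have := ltn_ord j; lia.
  by rewrite mulr1 -mulrA mulr_natl [p ^+ j * _]mulrC.
case: a e => [|a] e; last by apply: posa; lia.
case: m e => [//|m] e; rewrite compgf0S hornerM hornerX mul1r.
by apply: posa; lia.
Qed.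

(** The union bound over the spanning forests, obtained by dropping the powers
    of q from the exploration recursion. *)
Lemma compgf0_le a m : (P a m).[0] <= (nforests a m)%:R * p ^+ m.
Proof.
move: {2}(a + m)%N (erefl (a + m)%N) => t.
elim: t a m => [|t IH] [|a] m e; try by [].
- move: e; rewrite add0n => ->; by rewrite compgf00 hornerC mulr1.
- move: e; rewrite add0n => ->.
  by rewrite compgf0S hornerM hornerX mul0r /= mul0n mul0r.
rewrite compgfS horner_binom_mean -nforests_expose natr_sum mulr_suml.
apply: ler_sum => j _; have jm := ltn_ord j.
rewrite natrM -!mulrA ler_wpM2l //.
have -> : p ^+ m = p ^+ j * p ^+ (m - j) by rewrite -exprD; congr (_ ^+ _); lia.
rewrite [leRHS]mulrCA ler_wpM2l ?exprn_ge0 //.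
apply: le_trans (IH _ _ _); last by lia.
rewrite ler_piMl ?exprn_ile1 //.
by rewrite horner_coef0; apply: compgf_coef_ge0.
Qed.

(** Every step of the exploration costs at most one factor q for each vertex that
    it does not reach, and a + m steps suffice. *)
Lemma compgf0_ge a m :
  (nforests a m)%:R * p ^+ m * q ^+ ((a + m) ^ 2) <= (P a m).[0].
Proof.
move: {2}(a + m)%N (erefl (a + m)%N) => t.
elim: t a m => [|t IH] [|a] m e; try by [].
- move: e; rewrite add0n => ->; by rewrite compgf00 hornerC !mulr1.
- move: e; rewrite add0n => ->.
  by rewrite compgf0S hornerM hornerX !mul0r.
rewrite compgfS horner_binom_mean -nforests_expose natr_sum !mulr_suml.
apply: ler_sum => j _; have jm := ltn_ord j.
have /(IH _ _) IHj : (a + j + (m - j) = t)%N by lia.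
have -> : p ^+ m = p ^+ j * p ^+ (m - j) by rewrite -exprD; congr (_ ^+ _); lia.
rewrite natrM -!mulrA ler_wpM2l // [leLHS]mulrCA ler_wpM2l ?exprn_ge0 //.
apply: le_trans (ler_wpM2l (exprn_ge0 _ q0) IHj).
rewrite [leRHS]mulrC -!mulrA ler_wpM2l // ler_wpM2l ?exprn_ge0 //.
rewrite -exprD ler_wiXn2l //.
have -> : (a + j + (m - j) = a + m)%N by lia.
by rewrite addSn -addn1 sqrnD; lia.
Qed.

Lemma conn_prob_ge0 k : 0 <= conn_prob p k.
Proof.
case: k => //= k.
by rewrite horner_coef0; apply: compgf_coef_ge0.
Qed.

Lemma nforests1 k : nforests 1 k = (k.+1 ^ (k.+1 - 2))%N.
Proof. by case: k => [|k] //=; rewrite mul1n add1n subSS subSS subn0. Qed.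

Lemma conn_prob_le k : (0 < k)%N -> conn_prob p k <= (k ^ (k - 2))%:R * p ^+ k.-1.
Proof. by case: k => // k _; rewrite -nforests1; apply: compgf0_le. Qed.

Lemma conn_prob_ge k : (0 < k)%N ->
  (k ^ (k - 2))%:R * p ^+ k.-1 * q ^+ (k ^ 2) <= conn_prob p k.
Proof. by case: k => // k _; rewrite -nforests1; apply: compgf0_ge. Qed.

End ConnBounds.

(** * Factorial moments *)

Section FactorialMoments.
Variables (R : realFieldType) (p : R).
Hypothesis p01 : 0 <= p <= 1.
Local Notation q := (1 - p).
Local Notation P := (compgf p).
Local Notation kappa := (conn_prob p).

Let p0 : 0 <= p. Proof. by case/andP: p01. Qed.
Let q0 : 0 <= q. Proof. by case/andP: p01 => _; rewrite subr_ge0. Qed.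

(** The s-th factorial moment of the number of all components of G(m,p). *)
Definition all_moment s m : R := (P 0 m)^`(s).[1].
(** The s-th factorial moment of the number of components of G(n,p) that avoid a
    given vertex v, for n > 0. *)
Definition moment s n : R := (P 1 n.-1)^`(s).[1].
(** The expected number of components of size k that avoid v. *)
Definition comp_weight n k : R := 'C(n.-1, k)%:R * kappa k * q ^+ (k * (n - k)).
(** The probability that the component of v has k vertices. *)
Definition root_weight n k : R := 'C(n.-1, k.-1)%:R * kappa k * q ^+ (k * (n - k)).

Lemma deriv_compgf_ge0 a m s : 0 <= (P a m)^`(s).[1].
Proof.
rewrite horner_coef; apply: sumr_ge0 => i _.
by rewrite coef_derivn expr1n mulr1 mulrn_wge0 // compgf_coef_ge0.
Qed.

Lemma moment_ge0 s n : 0 <= moment s n. Proof. exact: deriv_compgf_ge0. Qed.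
Lemma all_moment_ge0 s n : 0 <= all_moment s n. Proof. exact: deriv_compgf_ge0. Qed.
Lemma comp_weight_ge0 n k : 0 <= comp_weight n k.
Proof. by rewrite !mulr_ge0 ?exprn_ge0 ?conn_prob_ge0. Qed.
Lemma root_weight_ge0 n k : 0 <= root_weight n k.
Proof. by rewrite !mulr_ge0 ?exprn_ge0 ?conn_prob_ge0. Qed.

Lemma moment0 n : moment 0 n = 1. Proof. exact: compgf_at1. Qed.

Lemma momentS s n : (0 < n)%N ->
  moment s.+1 n = \sum_(1 <= k < n) comp_weight n k * moment s (n - k).
Proof.
case: n => // m _; rewrite /moment derivSn /= deriv_compgf linear_sum /= horner_sum.
rewrite big_ord_recl /= mulr0 mul0r linearZ /= scale0r horner0 add0r.
rewrite big_add1 /= big_mkord.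
apply: eq_bigr => k _; rewrite linearZ hornerZ /= /comp_weight add1n subSS /=.
congr (_ * _); rewrite ?subSS //.
by have -> : ((m - k.+1) = (m - k).-1)%N by lia.
Qed.

Lemma moment_root s n : (0 < n)%N ->
  moment s n = \sum_(1 <= k < n.+1) root_weight n k * all_moment s (n - k).
Proof.
case: n => // m _; rewrite /moment compgf_root_closure linear_sum /= horner_sum.
rewrite big_add1 big_mkord.
by apply: eq_bigr => k _; rewrite linearZ hornerZ /root_weight add1n subSS.
Qed.

Lemma root_weight_sum n : (0 < n)%N -> \sum_(1 <= k < n.+1) root_weight n k = 1.
Proof.
move=> n0; rewrite -(moment0 n) moment_root //; apply: eq_bigr => k _.
by rewrite [all_moment _ _](compgf_at1 p01) mulr1.
Qed.

(** By symmetry a component of size k contains v with probability k/n and avoids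
    it with probability (n-k)/n. *)
Lemma comp_root_weight n k : (0 < k < n)%N ->
  k%:R * comp_weight n k = (n - k)%:R * root_weight n k.
Proof.
case: k => // k; case: n => // n /andP[_ kn]; rewrite /comp_weight /root_weight !mulrA /=.
congr (_ * _ * _); rewrite -!natrM; congr _%:R.
by rewrite subSS mul_bin_left.
Qed.

(** The components that avoid v have at most n vertices altogether. *)
Lemma sum_size_comp_weight n : (0 < n)%N ->
  \sum_(1 <= k < n) k%:R * comp_weight n k <= n%:R.
Proof.
move=> n0; rewrite -[leRHS]mulr1 -[X in _ * X](root_weight_sum n0) mulr_sumr.
rewrite [leRHS]big_nat_recr //= -[leLHS]addr0 lerD ?(mulr_ge0 _ (root_weight_ge0 _ _)) //.
apply: ler_sum_nat => k kn; rewrite comp_root_weight //.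
by rewrite ler_wpM2r ?root_weight_ge0 // ler_nat leq_subr.
Qed.

Lemma sum_comp_weight_tail K n : (0 < n)%N ->
  K%:R * \sum_(K.+1 <= k < n) comp_weight n k <= n%:R.
Proof.
move=> n0; apply: le_trans (sum_size_comp_weight n0).
rewrite mulr_sumr.
have [Kn|nK] := leqP K.+1 n; last first.
  rewrite big_geq; last exact: ltnW.
  by apply: sumr_ge0 => k _; rewrite mulr_ge0 ?comp_weight_ge0.
rewrite [leRHS](big_cat_nat (n := K.+1)) //= -[leLHS]add0r lerD //.
  by apply: sumr_ge0 => k _; rewrite mulr_ge0 ?comp_weight_ge0.
apply: ler_sum_nat => k /andP[Kk _].
by rewrite ler_wpM2r ?comp_weight_ge0 // ler_nat ltnW.
Qed.

Lemma moment_le s n : (0 < n)%N -> moment s n <= n%:R ^+ s.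
Proof.
elim: s n => [|s IH] n n0; first by rewrite moment0.
rewrite momentS // exprSr -[leRHS]mulrC.
apply: le_trans (_ : \sum_(1 <= k < n) (k%:R * comp_weight n k) * n%:R ^+ s <= _).
  apply: ler_sum_nat => k /andP[k0 kn].
  apply: ler_pM; rewrite ?comp_weight_ge0 ?moment_ge0 //.
    by rewrite ler_peMl ?comp_weight_ge0 // ler1n.
  apply: le_trans (IH _ _) _; first by rewrite subn_gt0.
  by rewrite lerXn2r ?nnegrE // ler_nat leq_subr.
by rewrite -mulr_suml ler_wpM2r ?exprn_ge0 // sum_size_comp_weight.
Qed.

(** If a component with k > n/2 vertices avoids v, then the component of v has
    i < n/2 vertices.  Exposing the component of v first, the large component is
    one of the components of a random graph on n - i vertices; among these it is
    unique, and it contains a given vertex with probability at least 1/2.  This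
    explains the factor 2 and the appearance of [moment s (n - i)]. *)
Lemma sum_large_le s n : (0 < n)%N ->
  \sum_(n./2.+1 <= k < n) comp_weight n k * moment s (n - k)
  <= 2%:R * \sum_(1 <= k < n./2.+1) root_weight n k * moment s (n - k).
Proof.
move=> n0; set L := n./2.
pose G k i : R := comp_weight n k * (root_weight (n - k) i * all_moment s (n - k - i)).
have G0 k i : 0 <= G k i.
  by rewrite /G mulr_ge0 ?comp_weight_ge0 // mulr_ge0 ?root_weight_ge0 ?all_moment_ge0.
rewrite (_ : \sum_(L.+1 <= k < n) _
  = \sum_(L.+1 <= k < n) \sum_(1 <= i < n.+1 | (i + k <= n)%N) G k i); last first.
  apply: eq_big_nat => k /andP[_ kn]; rewrite moment_root ?subn_gt0 // mulr_sumr.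
  rewrite (big_nat_widen _ _ n.+1) ?ltnS ?leq_subr //.
  by rewrite big_nat_cond [RHS]big_nat_cond; apply: eq_bigl => i; lia.
(* Since k > n/2 and i + k <= n, only i <= n/2 contribute. *)
rewrite (exchange_big_dep_nat xpredT) //=.
rewrite (big_cat_nat (n := L.+1)) //=; last by rewrite ltnS /L; lia.
rewrite [X in _ + X]big_nat_cond [X in _ + X]big1 ?addr0; last first.
  move=> i; rewrite andbT => /andP[Li ni]; rewrite big_nat_cond big1 // => k.
  by rewrite /L in Li *; lia.
rewrite mulr_sumr; apply: ler_sum_nat => i /andP[i0 iL].
have ni : (0 < n - i)%N by rewrite /L in iL; lia.
rewrite moment_root // mulr_sumr mulr_sumr.
rewrite (@big_nat_widenl _ _ _ L.+1 1) //.
rewrite (@big_nat_widen _ _ _ 1 (n - i).+1 n) /=; last by lia.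
rewrite big_mkcond [leRHS]big_mkcond /=; apply: ler_sum_nat => k /andP[k0 kn].
case: ifP => [/andP[ik Lk]|_]; last first.
  case: ifP => // _; rewrite mulr_ge0 // mulr_ge0 ?root_weight_ge0 // mulr_ge0 //.
    exact: root_weight_ge0.
  exact: all_moment_ge0.
have -> : (k < (n - i).+1)%N by lia.
rewrite /G mulrA [leRHS]mulrA [leRHS]mulrA.
have -> : (n - k - i = n - i - k)%N by lia.
rewrite ler_wpM2r ?all_moment_ge0 // /comp_weight /root_weight.
(* k C(n-i,k) = (n-i) C(n-i-1,k-1) and n - i < 2k. *)
have bin_le : ('C(n.-1, k) * 'C((n - k).-1, i.-1)
    <= 2 * 'C(n.-1, i.-1) * 'C((n - i).-1, k.-1))%N.
  have -> : ((n - k).-1 = n.-1 - k)%N by lia.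
  rewrite mul_binC; last by lia.
  have -> : (n.-1 - i.-1 = n - i)%N by lia.
  rewrite -mulnA mulnCA leq_mul2l; apply/orP; right.
  rewrite -(leq_pmul2l k0).
  have := mul_bin_diag (n - i) k.-1; rewrite prednK // => <-.
  rewrite mulnA leq_mul2r; apply/orP; right; rewrite /L in Lk; lia.
(* Both sides count the pairs of vertices in different parts of a partition
   into parts of sizes k, i and n - i - k. *)
have exp_eq : (k * (n - k) + i * (n - k - i) = i * (n - i) + k * (n - i - k))%N.
  have [r nr] : exists r, n = (r + i + k)%N by exists (n - i - k)%N; lia.
  have -> : (n - k - i = r)%N by lia.
  have -> : (n - i - k = r)%N by lia.
  have -> : (n - k = r + i)%N by lia.
  have -> : (n - i = r + k)%N by lia.
  by rewrite !mulnDr; lia.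
rewrite [leLHS](_ : _ = ('C(n.-1, k) * 'C((n - k).-1, i.-1))%:R
   * (kappa k * kappa i * q ^+ (k * (n - k) + i * (n - k - i)))); last first.
  by rewrite natrM exprD; ring.
rewrite exp_eq.
rewrite [leRHS](_ : _ = (2 * 'C(n.-1, i.-1) * 'C((n - i).-1, k.-1))%:R
   * (kappa k * kappa i * q ^+ (i * (n - i) + k * (n - i - k)))); last first.
  by rewrite !natrM exprD; ring.
rewrite ler_wpM2r ?ler_nat // mulr_ge0 ?exprn_ge0 // mulr_ge0 ?conn_prob_ge0 //.
Qed.

(** By [comp_root_weight], a small component of v is k/(n-k) <= 2k/n times as
    likely as a component of the same size that avoids v. *)
Lemma sum_large_by_small s n : (0 < n)%N ->
  n%:R * \sum_(n./2.+1 <= k < n) comp_weight n k * moment s (n - k)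
  <= 4%:R * \sum_(1 <= k < n./2.+1) k%:R * (comp_weight n k * moment s (n - k)).
Proof.
move=> n0; apply: le_trans (ler_wpM2l (ler0n _ _) (sum_large_le s n0)) _.
rewrite !mulr_sumr; apply: ler_sum_nat => k /andP[k0 kn].
case: (ltnP k n) => [kn'|nk].
  rewrite [k%:R * (_ * _)]mulrA comp_root_weight ?k0 //.
  have := root_weight_ge0 n k; have := moment_ge0 s (n - k).
  move: (root_weight n k) (moment s (n - k)) => u f f0 u0.
  rewrite !mulrA ler_wpM2r // ler_wpM2r //.
  by rewrite -!natrM ler_nat; lia.
by lia.
Qed.

End FactorialMoments.

(** * The truncated tree series and the lower bound *)

Definition treecoef (R : fieldType) k : R := (k ^ (k - 2))%:R / k`!%:R.

(** With y = n q^n this is the truncation at k = K of the series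
    p^-1 sum_k c_k (p y)^k; taking the factor p^-1 inside avoids divisions. *)
Definition treesum (R : fieldType) K (p y : R) : R :=
  \sum_(1 <= k < K.+1) treecoef R k * p ^+ k.-1 * y ^+ k.

Section TreeSum.
Variables (R : realFieldType) (p : R).
Hypothesis p0 : 0 <= p.
Local Notation c := (treecoef R).

Lemma treecoef_ge0 k : 0 <= c k. Proof. by rewrite mulr_ge0. Qed.

Lemma treecoef1 : c 1 = 1. Proof. by rewrite /treecoef divr1. Qed.

Lemma treesum_ge0 K y : 0 <= y -> 0 <= treesum K p y.
Proof.
by move=> y0; apply: sumr_ge0 => k _; rewrite !mulr_ge0 ?exprn_ge0 ?treecoef_ge0.
Qed.

Lemma treesum_ler K y z : 0 <= y -> y <= z -> treesum K p y <= treesum K p z.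
Proof.
move=> y0 yz; apply: ler_sum_nat => k _.
apply: ler_wpM2l; first by rewrite mulr_ge0 ?exprn_ge0 ?treecoef_ge0.
by rewrite lerXn2r ?nnegrE // (le_trans y0).
Qed.

Lemma treesum_scale_ge K t y : 0 <= t <= 1 -> 0 <= y ->
  t ^+ K * treesum K p y <= treesum K p (t * y).
Proof.
move=> /andP[t0 t1] y0; rewrite mulr_sumr; apply: ler_sum_nat => k /andP[_ kK].
rewrite exprMn [leLHS]mulrCA ler_wpM2l ?mulr_ge0 ?exprn_ge0 ?treecoef_ge0 //.
by rewrite ler_wpM2r ?exprn_ge0 // ler_wiXn2l.
Qed.

Lemma le_treesum K y : (0 < K)%N -> 0 <= y -> y <= treesum K p y.
Proof.
move=> K0 y0; rewrite /treesum big_ltn //= treecoef1 !mul1r expr1 lerDl.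
by apply: sumr_ge0 => k _; rewrite !mulr_ge0 ?exprn_ge0 ?treecoef_ge0.
Qed.
End TreeSum.

Lemma ffact_le_exp n k : (n ^_ k <= n ^ k)%N.
Proof.
elim: k n => [|k IH] n; first by rewrite ffactn0.
rewrite ffactnS expnS leq_mul //; apply: leq_trans (IH _) _.
by case: k {IH} => // k; rewrite leq_exp2r // leq_pred.
Qed.

Lemma exp_le_ffact n k : ((n.+1 - k) ^ k <= n ^_ k)%N.
Proof.
elim: k => [|k IH] //; rewrite ffactnSr expnSr subSS leq_mul //.
apply: leq_trans IH; case: k => // k.
by rewrite leq_exp2r //; apply: leq_sub2r.
Qed.

Section WeightBounds.
Variables (R : realFieldType) (p : R).
Hypothesis p01 : 0 <= p <= 1.
Local Notation q := (1 - p).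
Let p0 : 0 <= p. Proof. by case/andP: p01. Qed.
Let q0 : 0 <= q. Proof. by case/andP: p01 => _; rewrite subr_ge0. Qed.

Lemma comp_weight_le n k : (0 < k)%N ->
  comp_weight p n k <= treecoef R k * p ^+ k.-1 * (n%:R * q ^+ (n - k)) ^+ k.
Proof.
move=> k0; rewrite /comp_weight /treecoef exprMn -exprM [(k * _)%N]mulnC mulrA.
rewrite ler_wpM2r ?exprn_ge0 //.
apply: le_trans (_ : 'C(n.-1, k)%:R * ((k ^ (k - 2))%:R * p ^+ k.-1) <= _).
  by rewrite ler_wpM2l ?conn_prob_le.
rewrite [leRHS](_ : _ = (n%:R ^+ k / k`!%:R)
  * ((k ^ (k - 2))%:R * p ^+ k.-1)); last by ring.
rewrite ler_wpM2r ?mulr_ge0 ?exprn_ge0 // ler_pdivlMr ?ltr0n ?fact_gt0 //.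
rewrite -natrM -natrX ler_nat bin_ffact (leq_trans (ffact_le_exp _ _)) //.
by case: k k0 => // k _; rewrite leq_exp2r // leq_pred.
Qed.

Lemma comp_weight_ge n k : (0 < k < n)%N ->
  treecoef R k * p ^+ k.-1 * ((n - k)%:R * q ^+ n) ^+ k <= comp_weight p n k.
Proof.
move=> /andP[k0 kn].
rewrite /comp_weight /treecoef exprMn -exprM.
have -> : (n * k = k ^ 2 + k * (n - k))%N.
  by rewrite -mulnn -mulnDr subnKC 1?mulnC // ltnW.
rewrite exprD.
have := conn_prob_ge p01 k0; set u := _ * _ * _ => /(ler_wpM2l (ler0n R 'C(n.-1, k))) H.
rewrite [leRHS]mulrC -[leLHS]mulrC [leLHS](_ : _ = q ^+ (k * (n - k)) *
  ((n - k)%:R ^+ k / k`!%:R * u)); last by rewrite /u; ring.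
rewrite ler_wpM2l ?exprn_ge0 //; apply: le_trans H.
rewrite ler_wpM2r ?mulr_ge0 ?exprn_ge0 // ler_pdivrMr ?ltr0n ?fact_gt0 //.
rewrite -natrM -natrX ler_nat bin_ffact.
by have := exp_le_ffact n.-1 k; rewrite prednK //; apply: leq_trans k0 (ltnW kn).
Qed.

(** Only components of size at most K are used.  The deficit s K in the base
    n - s K makes the bound compatible with the removal of at most s components:
    n - k - (s-1) K >= n - s K for k <= K, and q^(n-k) >= q^n. *)
Lemma moment_lower s K n : (s * K < n)%N ->
  treesum K p ((n - s * K)%:R * q ^+ n) ^+ s <= moment p s n.
Proof.
elim: s n => [|s IH] n sKn; first by rewrite moment0.
have n0 : (0 < n)%N by apply: leq_ltn_trans sKn.
have Kn : (K.+1 <= n)%N by rewrite mulSn in sKn; lia.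
rewrite momentS // (big_cat_nat (n := K.+1)) //= -[leLHS]addr0 lerD //; last first.
  by apply: sumr_ge0 => k _; rewrite mulr_ge0 ?comp_weight_ge0 ?moment_ge0.
have y0 : 0 <= (n - s.+1 * K)%:R * q ^+ n by rewrite mulr_ge0 ?exprn_ge0.
rewrite exprS {1}/treesum mulr_suml; apply: ler_sum_nat => k /andP[k0 kK].
apply: ler_pM; rewrite ?exprn_ge0 ?treesum_ge0 //.
- by rewrite !mulr_ge0 ?exprn_ge0 ?treecoef_ge0.
- apply: le_trans (comp_weight_ge _); last by lia.
  rewrite ler_wpM2l ?mulr_ge0 ?exprn_ge0 ?treecoef_ge0 //.
  rewrite lerXn2r ?nnegrE ?mulr_ge0 ?exprn_ge0 // ler_wpM2r ?exprn_ge0 //.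
  by rewrite ler_nat mulSn; lia.
- have skn : (s * K < n - k)%N by rewrite mulSn in sKn; lia.
  apply: le_trans (IH _ skn).
  rewrite lerXn2r ?nnegrE ?treesum_ge0 ?mulr_ge0 ?exprn_ge0 //.
  apply: treesum_ler => //; apply: ler_pM; rewrite ?exprn_ge0 //.
    by rewrite ler_nat mulSn; lia.
  by rewrite ler_wiXn2l ?leq_subr ?gerBl.
Qed.

End WeightBounds.

(** * Convergence of the tree series *)

(** Telescoping: 1/(x+1)^2 <= 1/x - 1/(x+1). *)
Lemma sum_inv_sqr_tail (R : realFieldType) K N : (0 < K)%N ->
  \sum_(K.+1 <= k < N) (k%:R ^+ 2)^-1 <= K%:R^-1 :> R.
Proof.
move=> K0; have [NK|KN] := leqP N K.+1; first by rewrite big_geq // invr_ge0.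
suff H d : \sum_(K.+1 <= k < K.+1 + d) (k%:R ^+ 2)^-1 <= K%:R^-1 - (K + d)%:R^-1 :> R.
  rewrite -(subnKC (ltnW KN)); apply: le_trans (H _) _.
  by rewrite gerBl invr_ge0.
elim: d => [|d IH]; first by rewrite !addn0 big_geq // subrr.
rewrite addnS big_nat_recr ?leq_addr //=.
have x0 : 0 < (K + d)%:R :> R by rewrite ltr0n; lia.
have e : (K.+1 + d)%:R = (K + d)%:R + 1 :> R by rewrite addSn -natr1.
rewrite [in leRHS]addnS -[(K + d).+1]addSn e.
move: {e} (K + d)%:R IH x0 => x IH x0.
have xn0 : x != 0 by rewrite gt_eqF.
have x1n0 : x + 1 != 0 by rewrite gt_eqF // addr_gt0.
have Kn0 : K%:R != 0 :> R by rewrite pnatr_eq0; lia.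
apply: le_trans (lerD IH (lexx _)) _.
rewrite -subr_ge0.
have -> : K%:R^-1 - (x + 1)^-1 - (K%:R^-1 - x^-1 + ((x + 1) ^+ 2)^-1)
   = (x * (x + 1) ^+ 2)^-1 by field; rewrite xn0 x1n0 Kn0.
by rewrite invr_ge0 mulr_ge0 ?exprn_ge0 // ltW // addr_gt0.
Qed.

Section TreeSeries.
Variable R : realType.
Local Notation c := (treecoef R).
Local Notation e1 := (expR (1 : R)).

(** Since c_k = k^k / (k! k^2) and k^k / k! is a term of the exponential series
    at k. *)
Lemma treecoef_le k : (0 < k)%N -> c k <= e1 ^+ k / k%:R ^+ 2.
Proof.
case: k => // k _; rewrite /treecoef.
rewrite ler_pdivrMr ?ltr0n ?fact_gt0 // mulrAC ler_pdivlMr ?exprn_gt0 ?ltr0n //.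
have -> : (k.+1 ^ (k.+1 - 2))%:R * k.+1%:R ^+ 2 = k.+1%:R ^+ k.+1 :> R.
  rewrite -natrX -natrM -natrX; congr _%:R.
  by case: k => [|k] //; rewrite -expnD subSS subSS subn0 addn2.
rewrite -ler_pdivrMr ?ltr0n ?fact_gt0 // -expRM_natl mulr1.
by apply: le_trans (expR_ge1Dxn k _) => //; rewrite lerDr.
Qed.

Lemma tree_term_le k (p y : R) : (0 < k)%N -> 0 <= p -> 0 <= y -> e1 * (p * y) <= 1 ->
  c k * p ^+ k.-1 * y ^+ k <= e1 * y / k%:R ^+ 2.
Proof.
move=> k0 p0 y0 epy.
have py0 : 0 <= e1 * (p * y) by rewrite !mulr_ge0 ?expR_ge0.
apply: le_trans (_ : (e1 ^+ k / k%:R ^+ 2) * p ^+ k.-1 * y ^+ k <= _).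
  by rewrite -[leLHS]mulrA -[leRHS]mulrA ler_wpM2r ?treecoef_le // mulr_ge0 ?exprn_ge0.
case: k k0 => // k _; rewrite [k.+1.-1]/=.
have -> : (e1 ^+ k.+1 / k.+1%:R ^+ 2) * p ^+ k * y ^+ k.+1
   = (e1 * (p * y)) ^+ k * (e1 * y / k.+1%:R ^+ 2).
  by rewrite !exprMn !exprS; ring.
by rewrite ler_piMl ?exprn_ile1 // !mulr_ge0 ?expR_ge0 ?invr_ge0 ?exprn_ge0.
Qed.

Lemma treesum_tail K N (p y : R) : (0 < K)%N -> 0 <= p -> 0 <= y ->
  e1 * (p * y) <= 1 ->
  \sum_(K.+1 <= k < N) c k * p ^+ k.-1 * y ^+ k <= e1 * y / K%:R.
Proof.
move=> K0 p0 y0 epy.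
apply: le_trans (_ : \sum_(K.+1 <= k < N) e1 * y * (k%:R ^+ 2)^-1 <= _).
  by apply: ler_sum_nat => k /andP[Kk _]; apply: tree_term_le => //; lia.
by rewrite -mulr_sumr ler_wpM2l ?sum_inv_sqr_tail // mulr_ge0 ?expR_ge0.
Qed.

Lemma treesum_le K (p y : R) : 0 <= p -> 0 <= y -> e1 * (p * y) <= 1 ->
  treesum K p y <= 2 * e1 * y.
Proof.
move=> p0 y0 epy; have ey0 : 0 <= e1 * y by rewrite mulr_ge0 ?expR_ge0.
case: K => [|K]; first by rewrite /treesum big_geq // -mulrA mulr_ge0.
rewrite /treesum big_ltn //.
have := @tree_term_le 1 p y isT p0 y0 epy.
have := @treesum_tail 1 K.+2 p y isT p0 y0 epy.
rewrite expr1n divr1; lra.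
Qed.

(** The remainder after the term K is at most e y / K. *)
Lemma tree_series_bounds K (p y : R) : (0 < K)%N -> 0 < p -> 0 <= y ->
  e1 * (p * y) <= 1 ->
  treesum K p y <= p^-1 * tree_series (p * y) <= treesum K p y + e1 * y / K%:R.
Proof.
move=> K0 p0 y0 epy.
pose u N : R := \sum_(1 <= k < N) c k * (p * y) ^+ k.
have uE N : u N = p * \sum_(1 <= k < N) c k * p ^+ k.-1 * y ^+ k.
  rewrite /u mulr_sumr; apply: eq_big_nat => -[//|k] _.
  by rewrite exprMn exprS /=; ring.
have t0 k : 0 <= c k * p ^+ k.-1 * y ^+ k.
  by rewrite !mulr_ge0 ?treecoef_ge0 ?exprn_ge0 // ltW.
have ple N : u N <= p * (treesum K p y + e1 * y / K%:R).
  rewrite uE ler_wpM2l ?(ltW p0) //.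
  have [NK|KN] := leqP N K.+1.
    have -> : treesum K p y = \sum_(1 <= k < N.-1.+1) c k * p ^+ k.-1 * y ^+ k
       + \sum_(N.-1.+1 <= k < K.+1) c k * p ^+ k.-1 * y ^+ k.
      by rewrite /treesum -big_cat_nat //; lia.
    have -> : \sum_(1 <= k < N) c k * p ^+ k.-1 * y ^+ k
      = \sum_(1 <= k < N.-1.+1) c k * p ^+ k.-1 * y ^+ k.
      by case: (N) => //; rewrite !big_geq.
    rewrite -addrA lerDl addr_ge0 ?sumr_ge0 //.
    by rewrite !mulr_ge0 ?invr_ge0 ?expR_ge0.
  rewrite (big_cat_nat (n := K.+1)) //=; last exact: ltnW.
  rewrite lerD2l.
  by apply: treesum_tail => //; apply: ltW.
have undec : {homo u : n m / (n <= m)%N >-> n <= m}.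
  move=> n m nm; rewrite !uE ler_wpM2l ?(ltW p0) //.
  case: n nm => [|n] nm; first by rewrite big_geq // sumr_ge0.
  by rewrite [leRHS](big_cat_nat (n := n.+1)) //= lerDl sumr_ge0.
have ucvg : cvgn u.
  apply: nondecreasing_is_cvgn => //.
  by exists (p * (treesum K p y + e1 * y / K%:R)) => _ [N _ <-].
have -> : tree_series (p * y) = limn u by [].
rewrite ler_pdivlMl // ler_pdivrMl //; apply/andP; split.
  have := nondecreasing_cvgn_le undec ucvg K.+1.
  by rewrite uE.
by apply: limr_le => //; apply: nearW.
Qed.

(** With t = n p, this is e t exp(-t) <= 1, that is, t <= exp(t - 1). *)
Lemma tree_arg_le (p : R) n : 0 <= p <= 1 ->
  e1 * (p * (n%:R * (1 - p) ^+ n)) <= 1.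
Proof.
move=> /andP[p0 p1].
have qe : (1 - p) ^+ n <= expR (- (n%:R * p)).
  rewrite -mulrN expRM_natl lerXn2r ?nnegrE ?expR_ge0 ?subr_ge0 //.
  exact: expR_ge1Dx.
apply: le_trans (_ : e1 * (n%:R * p * expR (- (n%:R * p))) <= _).
  rewrite ler_wpM2l ?expR_ge0 // mulrCA mulrA ler_wpM2l // mulr_ge0 //.
rewrite mulrCA -expRD.
have := expR_ge1Dx (n%:R * p - 1); rewrite addrC subrK => H.
apply: le_trans (ler_wpM2r (expR_ge0 _) H) _.
by rewrite -expRD (_ : _ + _ = 0) ?expR0 //; lra.
Qed.

End TreeSeries.

(** * The upper bound *)

Section UpperBound.
Variable R : realType.
Local Notation c := (treecoef R).
Local Notation e1 := (expR (1 : R)).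

Lemma nat_above (x : R) : exists K : nat, x <= K%:R.
Proof.
exists (Num.bound x); apply: le_trans (real_ler_norm _) _; first exact: num_real.
by have := archi_boundP (normr_ge0 x); rewrite /Num.bound normr_id => /ltW.
Qed.

Lemma le1DX (x : R) s : 0 <= x -> x <= 1 + x ^+ s.+1.
Proof.
move=> x0; have [x1|x1] := leP x 1; first by rewrite (le_trans x1) // lerDl exprn_ge0.
apply: le_trans (_ : x ^+ s.+1 <= _); last by rewrite lerDr.
by rewrite exprS ler_peMr // exprn_ege1 // ltW.
Qed.

(** By [sum_large_by_small] the sizes k > n/2 contribute at most 4k/n times the
    small ones; this factor is at most 4K/n for k <= K and at most 2 for
    k <= n/2. *)
Lemma moment_split (p : R) s n K : 0 <= p <= 1 -> (0 < n)%N -> (K <= n./2)%N ->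
  moment p s.+1 n <=
    (1 + 4 * K%:R / n%:R) * \sum_(1 <= k < K.+1) comp_weight p n k * moment p s (n - k)
    + 3 * \sum_(K.+1 <= k < n./2.+1) comp_weight p n k * moment p s (n - k).
Proof.
move=> p01 n0 Kn.
pose f k := comp_weight p n k * moment p s (n - k).
have f0 k : 0 <= f k by rewrite mulr_ge0 ?comp_weight_ge0 ?moment_ge0.
case: (ltnP 1 n) => n1; last first.
  rewrite momentS // big_geq //.
  have c0 : 0 <= 1 + 4 * K%:R / n%:R :> R by rewrite addr_ge0 // divr_ge0 // mulr_ge0.
  by apply: addr_ge0; apply: mulr_ge0 => //; apply: sumr_ge0 => k _; exact: f0.
have nR : 0 < n%:R :> R by rewrite ltr0n.
rewrite momentS // (big_cat_nat (n := n./2.+1)) //=; last by lia.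
rewrite (big_cat_nat (n := K.+1)) //=.
set A := \sum_(1 <= k < K.+1) _; set B := \sum_(K.+1 <= k < _) _.
have := sum_large_by_small p01 s n0.
set T := \sum_(n./2.+1 <= k < n) _ => HT.
have HA : \sum_(1 <= k < K.+1) k%:R * f k <= K%:R * A.
  rewrite mulr_sumr; apply: ler_sum_nat => k /andP[_ kK].
  by rewrite ler_wpM2r // ler_nat.
have HB : \sum_(K.+1 <= k < n./2.+1) k%:R * f k <= (n%:R / 2) * B.
  rewrite mulr_sumr; apply: ler_sum_nat => k /andP[_ kK].
  rewrite ler_wpM2r // ler_pdivlMr // -natrM ler_nat; lia.
rewrite (big_cat_nat (n := K.+1)) //= in HT.
have HT' : T <= 4 * K%:R / n%:R * A + 2 * B.
  rewrite -(ler_pM2l nR); apply: le_trans HT _.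
  have -> : n%:R * (4 * K%:R / n%:R * A + 2 * B) = 4 * (K%:R * A + n%:R / 2 * B).
    by field; rewrite gt_eqF.
  by rewrite ler_pM2l // lerD.
rewrite mulrDl mul1r; lra.
Qed.

(** 1 - p >= exp(-2p) for p <= 1/2. *)
Lemma le_exp_moderate (p M : R) n : 0 <= p <= 2^-1 -> n%:R * p <= M ->
  n%:R <= expR (2 * M) * (n%:R * (1 - p) ^+ n).
Proof.
move=> /andP[p0 p2] npM.
have H : 1 <= (1 - p) * expR (2 * p).
  have q0 : 0 <= 1 - p by lra.
  apply: le_trans (ler_wpM2l q0 (expR_ge1Dx _)); nra.
have {}H : 1 <= (1 - p) ^+ n * expR (2 * M).
  apply: le_trans (_ : ((1 - p) * expR (2 * p)) ^+ n <= _); first exact: exprn_ege1.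
  rewrite exprMn -expRM_natl ler_wpM2l ?exprn_ge0 ?ler_expR //; lra.
by rewrite mulrCA ler_peMr // mulrC.
Qed.

(** There are at most n/K components of size above K, and each leaves a factor
    at most n^s; for n p <= M the number n is comparable to n q^n. *)
Lemma tail_moderate (p M : R) s n K L : 0 <= p <= 2^-1 -> n%:R * p <= M ->
  (0 < n)%N -> (L <= n)%N ->
  K%:R * \sum_(K.+1 <= k < L) comp_weight p n k * moment p s (n - k)
  <= expR (2 * M) ^+ s.+1 * (n%:R * (1 - p) ^+ n) ^+ s.+1.
Proof.
move=> p2 npM n0 Ln; have p01 : 0 <= p <= 1 by lra.
have w0 k : 0 <= comp_weight p n k * n%:R ^+ s.
  by rewrite mulr_ge0 ?comp_weight_ge0 ?exprn_ge0.
apply: le_trans (_ : n%:R ^+ s.+1 <= _); last first.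
  rewrite -exprMn lerXn2r ?nnegrE ?(le_exp_moderate p2) //.
  by rewrite !mulr_ge0 ?expR_ge0 ?exprn_ge0 //; lra.
apply: le_trans (_ : K%:R * \sum_(K.+1 <= k < n) comp_weight p n k * n%:R ^+ s <= _).
  rewrite ler_wpM2l //.
  apply: le_trans (_ : \sum_(K.+1 <= k < L) comp_weight p n k * n%:R ^+ s <= _).
    apply: ler_sum_nat => k /andP[_ kL]; rewrite ler_wpM2l ?comp_weight_ge0 //.
    apply: le_trans (moment_le p01 _ _) _; first by lia.
    by rewrite lerXn2r ?nnegrE // ler_nat leq_subr.
  have [LK|KL] := leqP L K.+1; first by rewrite big_geq // sumr_ge0.
  by rewrite [leRHS](big_cat_nat (n := L)) ?(ltnW KL) //= lerDl sumr_ge0.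
rewrite -mulr_suml mulrA exprS ler_wpM2r ?exprn_ge0 //.
exact: sum_comp_weight_tail.
Qed.

(** The factor q^(k(n-k)) is shared out: q^(ks) turns the moment bound for n - k
    vertices into the one for n vertices, since q^k (n-k) q^(n-k) <= n q^n, and
    the exponent n - k - s >= n/4 is left for each of the k factors. *)
Lemma comp_term_le_tree (p A : R) s n k : 0 <= p <= 1 -> 0 <= A ->
  (forall m, (0 < m)%N -> moment p s m <= A * (1 + (m%:R * (1 - p) ^+ m) ^+ s)) ->
  (4 * s <= n)%N -> (0 < k)%N -> (k <= n./2)%N -> (k < n)%N ->
  comp_weight p n k * moment p s (n - k)
  <= A * (1 + (n%:R * (1 - p) ^+ n) ^+ s)
     * (c k * p ^+ k.-1 * (n%:R * (1 - p) ^+ (n %/ 4)) ^+ k).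
Proof.
move=> p01 A0 HA sn k0 kn kn'; have [p0 p1] := andP p01.
set q := 1 - p; have q0 : 0 <= q by rewrite subr_ge0.
have q1 : q <= 1 by rewrite gerBl.
have cp0 : 0 <= c k * p ^+ k.-1 by rewrite mulr_ge0 ?treecoef_ge0 ?exprn_ge0.
have nk0 : (0 < n - k)%N by lia.
apply: le_trans (_ : (c k * p ^+ k.-1 * (n%:R * q ^+ (n - k)) ^+ k)
   * (A * (1 + ((n - k)%:R * q ^+ (n - k)) ^+ s)) <= _).
  by apply: ler_pM; rewrite ?comp_weight_ge0 ?moment_ge0 ?comp_weight_le ?HA.
rewrite [leLHS]mulrCA -[leRHS]mulrA ler_wpM2l //.
rewrite [leRHS]mulrCA -[leLHS]mulrA ler_wpM2l //.
rewrite !exprMn -[leLHS]mulrA [leRHS]mulrCA ler_wpM2l ?exprn_ge0 //.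
have -> : (q ^+ (n - k)) ^+ k = q ^+ ((n - k - s) * k) * (q ^+ k) ^+ s.
  rewrite -!exprM -exprD; congr (_ ^+ _).
  by rewrite [(k * s)%N]mulnC -mulnDl subnK //; lia.
rewrite -mulrA [leRHS]mulrC; apply: ler_pM; rewrite ?exprn_ge0 //.
- by rewrite mulr_ge0 ?exprn_ge0 // addr_ge0 // mulr_ge0 ?exprn_ge0.
- rewrite -exprM ler_wiXn2l // leq_mul2r; apply/orP; right; lia.
rewrite mulrDr mulr1 lerD ?exprn_ile1 ?exprn_ge0 //.
rewrite -!exprMn lerXn2r ?nnegrE ?mulr_ge0 ?exprn_ge0 //.
rewrite mulrCA -exprD subnKC; last by lia.
by rewrite ler_wpM2r ?exprn_ge0 // ler_nat leq_subr.
Qed.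

(** exp(t/5) = exp(t/30)^6 >= (t/30)^6. *)
Lemma pow5_exp_small (eta : R) : 0 < eta ->
  exists2 M : R, 1 <= M & forall t, M <= t -> t ^+ 5 * expR (- (t / 5)) <= eta.
Proof.
move=> eta0; pose M := 1 + 30 ^+ 6 / eta.
have M1 : 1 <= M by rewrite lerDl mulr_ge0 ?invr_ge0 ?exprn_ge0 // ltW.
exists M => // t Mt; have t0 : 0 < t by lra.
rewrite expRN ler_pdivrMr ?expR_gt0 //.
have -> : t / 5 = 6%:R * (t / 30) by field.
rewrite expRM_natl.
have H : (t / 30) ^+ 6 <= expR (t / 30) ^+ 6.
  rewrite lerXn2r ?nnegrE ?expR_ge0 ?divr_ge0 ?(ltW t0) //.
  by apply: le_trans (expR_ge1Dx _); rewrite lerDr.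
apply: le_trans (ler_wpM2l (ltW eta0) H).
have H2 : 30 ^+ 6 <= eta * t.
  by rewrite mulrC -ler_pdivrMr //; rewrite /M in Mt; lra.
rewrite exprMn exprVn mulrA ler_pdivlMr ?exprn_gt0 //.
have -> : eta * t ^+ 6 = (eta * t) * t ^+ 5 by ring.
by rewrite [leLHS]mulrC; apply: ler_wpM2r => //; apply: exprn_ge0; apply: ltW.
Qed.

Lemma expB_le_expR (p : R) n d : 0 <= p <= 1 -> (n <= 5 * d)%N ->
  (1 - p) ^+ d <= expR (- (n%:R * p / 5)).
Proof.
move=> /andP[p0 p1] nd.
apply: le_trans (_ : expR (- p) ^+ d <= _).
  by rewrite lerXn2r ?nnegrE ?expR_ge0 ?subr_ge0 // expR_ge1Dx.
rewrite -expRM_natl ler_expR mulrN lerN2 ler_pdivrMr //.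
rewrite mulrAC ler_wpM2r // -natrM ler_nat; lia.
Qed.

(** The terms of the tree series from the sixth on contain the factor (p z)^5.
    For z = n q^d with d about n/4 it provides 5 d >= n further factors q, which
    make up for the difference between q^d and q^n. *)
Lemma tree_term_le_pow5 k (p z : R) : (6 <= k)%N -> 0 <= p -> 0 <= z ->
  e1 * (p * z) <= 1 ->
  c k * p ^+ k.-1 * z ^+ k <= e1 ^+ 6 * (z * (p * z) ^+ 5) / k%:R ^+ 2.
Proof.
move=> k6 p0 z0 epz.
have pz0 : 0 <= e1 * (p * z) by rewrite !mulr_ge0 ?expR_ge0.
apply: le_trans (_ : (e1 ^+ k / k%:R ^+ 2) * p ^+ k.-1 * z ^+ k <= _).
  rewrite -[leLHS]mulrA -[leRHS]mulrA ler_wpM2r ?treecoef_le //; last by lia.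
  by rewrite mulr_ge0 ?exprn_ge0.
have [j ->] : exists j, k = (j + 6)%N by exists (k - 6)%N; lia.
have -> : (j + 6).-1 = (j + 5)%N by lia.
have -> : (e1 ^+ (j + 6) / (j + 6)%:R ^+ 2) * p ^+ (j + 5) * z ^+ (j + 6)
   = (e1 * (p * z)) ^+ j * (e1 ^+ 6 * (z * (p * z) ^+ 5) / (j + 6)%:R ^+ 2).
  by rewrite !exprMn !exprD; move: ((_ ^+ 2)^-1) => x; ring.
rewrite ler_piMl ?exprn_ile1 // !mulr_ge0 ?invr_ge0 ?exprn_ge0 ?expR_ge0 //.
Qed.

Lemma leq_5_div4 n : (16 <= n)%N -> (n <= 5 * (n %/ 4))%N.
Proof. lia. Qed.

Lemma half_lt n : (2 <= n)%N -> (n./2 < n)%N.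
Proof. lia. Qed.

(** For large t = n p the number t^5 q^(n/4) is small, so that the sizes above 5
    contribute little compared to n q^n. *)
Lemma tail_dense (p A eta : R) s n K : 0 <= p <= 1 -> 0 <= A ->
  (forall m, (0 < m)%N -> moment p s m <= A * (1 + (m%:R * (1 - p) ^+ m) ^+ s)) ->
  (4 * s <= n)%N -> (16 <= n)%N -> (5 <= K)%N ->
  e1 * (p * (n%:R * (1 - p) ^+ (n %/ 4))) <= 1 ->
  (n%:R * p) ^+ 5 * (1 - p) ^+ (n %/ 4) <= eta ->
  \sum_(K.+1 <= k < n./2.+1) comp_weight p n k * moment p s (n - k)
  <= A * (1 + (n%:R * (1 - p) ^+ n) ^+ s)
     * (e1 ^+ 6 * (n%:R * (1 - p) ^+ n * eta)).
Proof.
move=> p01 A0 HA sn n16 K5 epz etaP.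
have [p0 p1] := andP p01.
set q := 1 - p in HA epz etaP *; have q0 : 0 <= q by rewrite subr_ge0.
have q1 : q <= 1 by rewrite gerBl.
set d := (n %/ 4)%N in epz etaP *; set z := n%:R * q ^+ d in epz.
have z0 : 0 <= z by rewrite mulr_ge0 ?exprn_ge0.
have A1 : 0 <= A * (1 + (n%:R * q ^+ n) ^+ s).
  by rewrite mulr_ge0 // addr_ge0 // exprn_ge0 // mulr_ge0 ?exprn_ge0.
apply: le_trans (_ : \sum_(K.+1 <= k < n./2.+1) A * (1 + (n%:R * q ^+ n) ^+ s)
    * (e1 ^+ 6 * (z * (p * z) ^+ 5) * (k%:R ^+ 2)^-1) <= _).
  apply: ler_sum_nat => k /andP[Kk kn].
  have [k0 kn2 kn1 k6] : [/\ 0 < k, k <= n./2, k < n & 6 <= k]%N.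
    by clear -Kk kn K5 n16; split; lia.
  apply: le_trans (comp_term_le_tree p01 A0 HA sn k0 kn2 kn1) _.
  by apply: ler_wpM2l => //; apply: tree_term_le_pow5.
rewrite -mulr_sumr ler_wpM2l // -mulr_sumr -[leLHS]mulrA.
rewrite ler_wpM2l ?exprn_ge0 ?expR_ge0 //.
have K0 : (0 < K)%N by clear -K5; lia.
apply: le_trans (_ : z * (p * z) ^+ 5 * 1 <= _).
  apply: ler_wpM2l; first by rewrite mulr_ge0 // exprn_ge0 // mulr_ge0.
  apply: le_trans (sum_inv_sqr_tail _ _ K0) _.
  by rewrite invf_le1 ?ler1n // ltr0n.
rewrite mulr1.
have -> : z * (p * z) ^+ 5 = n%:R * (q ^+ (5 * d)) * ((n%:R * p) ^+ 5 * q ^+ d).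
  by rewrite /z !exprMn mulnC exprM; ring.
apply: ler_pM; last exact: etaP.
- by rewrite mulr_ge0 ?exprn_ge0.
- by rewrite mulr_ge0 ?exprn_ge0 // mulr_ge0.
by rewrite ler_wpM2l ?ler0n //; apply: (ler_wiXn2l q0 q1); apply: leq_5_div4.
Qed.

(** If even n q^(n/4) is small, then all sizes are negligible. *)
Lemma sum_small_dense (p A : R) s n : 0 <= p <= 1 -> 0 <= A ->
  (forall m, (0 < m)%N -> moment p s m <= A * (1 + (m%:R * (1 - p) ^+ m) ^+ s)) ->
  (4 * s <= n)%N -> (2 <= n)%N ->
  n%:R * (1 - p) ^+ (n %/ 4) <= e1^-1 ->
  \sum_(1 <= k < n./2.+1) comp_weight p n k * moment p s (n - k)
  <= 4 * A * e1 * (n%:R * (1 - p) ^+ (n %/ 4)).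
Proof.
move=> p01 A0 HA sn n2 zle; have [p0 p1] := andP p01.
set q := 1 - p in HA zle *; have q0 : 0 <= q by rewrite subr_ge0.
have q1 : q <= 1 by rewrite gerBl.
set d := (n %/ 4)%N in zle *; set z := n%:R * q ^+ d in zle *.
have z0 : 0 <= z by rewrite mulr_ge0 ?exprn_ge0.
have e1ge1 : 1 <= e1 by rewrite -[leLHS]expR0 ler_expR.
have z1 : z <= 1 by apply: le_trans zle _; rewrite invf_le1 ?expR_gt0.
have ez : e1 * z <= 1 by rewrite mulrC -ler_pdivlMr ?expR_gt0 // div1r.
have epz : e1 * (p * z) <= 1.
  by apply: le_trans ez; rewrite ler_wpM2l ?expR_ge0 // ler_piMl.
have mu0 : 0 <= n%:R * q ^+ n by rewrite mulr_ge0 ?exprn_ge0.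
have mu1 : n%:R * q ^+ n <= 1.
  apply: le_trans z1; rewrite /z ler_wpM2l ?ler0n //.
  by apply: (ler_wiXn2l q0 q1); apply: leq_div.
apply: le_trans (_ : 2 * A * treesum n./2 p z <= _); last first.
  have -> : 4 * A * e1 * z = 2 * A * (2 * e1 * z) by ring.
  by rewrite ler_wpM2l ?mulr_ge0 // treesum_le.
rewrite mulr_sumr; apply: ler_sum_nat => k /andP[k0 kn].
have kn1 : (k < n)%N by apply: (leq_trans kn); apply: half_lt.
have kn2 : (k <= n./2)%N by [].
apply: le_trans (comp_term_le_tree p01 A0 HA sn k0 kn2 kn1) _.
rewrite ler_wpM2r //; first by rewrite !mulr_ge0 ?treecoef_ge0 ?exprn_ge0.
rewrite mulrC ler_wpM2r //.
have := exprn_ile1 s mu0 mu1; lra.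
Qed.

(** A term of the sum differs from the corresponding product of tree terms by
    powers of q only: for j, k <= K, passing from q^(n-k) to q^n inside a j-th
    power costs q^(kj) >= q^(K^2), once for the weight and s times for the
    moment. *)
Lemma main_terms_le (p e : R) s n K : 0 <= p <= 1 -> 0 <= e -> (K < n)%N ->
  (forall k, (k <= K)%N -> moment p s (n - k)
     <= (1 + e) * treesum K p ((n - k)%:R * (1 - p) ^+ (n - k)) ^+ s + e) ->
  (1 - p) ^+ (K * K * s.+1) *
    \sum_(1 <= k < K.+1) comp_weight p n k * moment p s (n - k)
  <= treesum K p (n%:R * (1 - p) ^+ n)
     * ((1 + e) * treesum K p (n%:R * (1 - p) ^+ n) ^+ s + e).
Proof.
move=> p01 e0 Kn IH; have [p0 p1] := andP p01.
set q := 1 - p in IH *; have q0 : 0 <= q by rewrite subr_ge0.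
have q1 : q <= 1 by rewrite gerBl.
set L := treesum K p (n%:R * q ^+ n).
set r := q ^+ (K * K); have r0 : 0 <= r by rewrite exprn_ge0.
have r1 : r <= 1 by rewrite exprn_ile1.
rewrite exprM -/r exprS.
have shift k j : (k <= K)%N -> (j <= K)%N ->
    r * (n%:R * q ^+ (n - k)) ^+ j <= (n%:R * q ^+ n) ^+ j.
  move=> kK jK; rewrite !exprMn mulrCA ler_wpM2l ?exprn_ge0 //.
  rewrite /r -!exprM -exprD ler_wiXn2l // mulnBl.
  have : (k * j <= K * K)%N by apply: leq_mul.
  have knj : (k * j <= n * j)%N by rewrite leq_mul2r (leq_trans kK (ltnW Kn)) orbT.
  by rewrite addnBA // => kjK; rewrite leq_subRL ?leq_add // (leq_trans knj) // leq_addl.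
rewrite mulr_sumr {1}/L {1}/treesum mulr_suml.
apply: ler_sum_nat => k /andP[k0 kK].
rewrite (_ : r * r ^+ s * _
  = (r * comp_weight p n k) * (r ^+ s * moment p s (n - k))); last by ring.
apply: ler_pM.
- exact: mulr_ge0 r0 (comp_weight_ge0 p01 _ _).
- exact: mulr_ge0 (exprn_ge0 _ r0) (moment_ge0 p01 _ _).
- apply: le_trans (ler_wpM2l r0 (comp_weight_le p01 n k0)) _.
  rewrite mulrCA ler_wpM2l ?mulr_ge0 ?treecoef_ge0 ?exprn_ge0 //.
  exact: shift.
- have kK' : (k <= K)%N by [].
  apply: le_trans (ler_wpM2l (exprn_ge0 s r0) (IH k kK')) _.
  rewrite mulrDr lerD //; last by rewrite ler_piMl ?exprn_ile1.
  rewrite mulrCA ler_wpM2l ?addr_ge0 // -exprMn.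
  have y0 : 0 <= (n - k)%:R * q ^+ (n - k) by rewrite mulr_ge0 ?exprn_ge0.
  have y0' : 0 <= n%:R * q ^+ n by rewrite mulr_ge0 ?exprn_ge0.
  rewrite lerXn2r ?nnegrE ?mulr_ge0 ?treesum_ge0 //.
  rewrite /L /treesum mulr_sumr; apply: ler_sum_nat => j /andP[j0 jK].
  rewrite mulrCA ler_wpM2l ?mulr_ge0 ?treecoef_ge0 ?exprn_ge0 //.
  apply: le_trans (shift k j kK' jK).
  rewrite ler_wpM2l // lerXn2r ?nnegrE ?mulr_ge0 ?exprn_ge0 //.
  by rewrite ler_wpM2r ?exprn_ge0 // ler_nat leq_subr.
Qed.

Local Notation lam K p n := (treesum K p (n%:R * (1 - p) ^+ n)).

(** The order of the quantifiers matters: N depends on the truncation K, and the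
    bound is uniform in p. *)
Definition moment_upper_estimate s := forall e : R, 0 < e -> exists K0, forall K,
  (K0 <= K)%N -> exists N, forall n, (N <= n)%N -> forall p : R, 0 < p < 1 ->
  moment p s n <= (1 + e) * lam K p n ^+ s + e.

(** The estimate gives the claim for large n because the tree sum is at most
    2 e n q^n; for n < N the moment is at most N^s. *)
Lemma moment_uniform_bound s : moment_upper_estimate s ->
  exists2 A : R, 0 <= A & forall (p : R) n, 0 < p < 1 -> (0 < n)%N ->
    moment p s n <= A * (1 + (n%:R * (1 - p) ^+ n) ^+ s).
Proof.
move=> /(_ 1 ltr01)[K0 /(_ K0 (leqnn _))[N HN]].
pose A : R := 2 * (2 * e1) ^+ s + 1 + N%:R ^+ s.
have B0 : 0 <= (2 * e1) ^+ s by rewrite exprn_ge0 // mulr_ge0 ?expR_ge0.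
have N0 : 0 <= N%:R ^+ s :> R by rewrite exprn_ge0.
have A0 : 0 <= A by rewrite /A; lra.
exists A => // p n /andP[p0 p1] n0.
have p01 : 0 <= p <= 1 by rewrite !ltW.
have mu0 : 0 <= n%:R * (1 - p) ^+ n by rewrite mulr_ge0 ?exprn_ge0 // subr_ge0 ltW.
have mus0 := exprn_ge0 s mu0.
have [Nn|nN] := leqP N n.
  apply: le_trans (HN n Nn p _) _; first by rewrite p0.
  have H : lam K0 p n ^+ s <= (2 * e1) ^+ s * (n%:R * (1 - p) ^+ n) ^+ s.
    have tl := treesum_le K0 (ltW p0) mu0 (tree_arg_le n p01).
    have t0 := treesum_ge0 (ltW p0) K0 mu0.
    by rewrite -exprMn lerXn2r ?nnegrE ?(le_trans t0 tl).
  rewrite /A; nra.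
apply: le_trans (moment_le p01 s n0) _.
apply: le_trans (_ : N%:R ^+ s <= _).
  by rewrite lerXn2r ?nnegrE // ler_nat ltnW.
rewrite /A; nra.
Qed.

Lemma bernoulli_exprB (p : R) m : 0 <= p <= 1 -> 1 - m%:R * p <= (1 - p) ^+ m.
Proof.
move=> /andP[p0 p1]; elim: m => [|m IH]; first by rewrite mul0r subr0.
rewrite exprS -natr1; apply: le_trans (ler_wpM2l _ IH); last by rewrite subr_ge0.
have : 0 <= m%:R * p * p by rewrite !mulr_ge0.
nra.
Qed.

(** The powers of q lost in [main_terms_le] have a bounded exponent, so they are
    close to 1 for small p. *)
Lemma main_terms_small_p s K N (e : R) : 0 < e -> e <= 1 ->
  (forall n, (N <= n)%N -> forall p : R, 0 < p < 1 ->
    moment p s n <= (1 + e) * lam K p n ^+ s + e) ->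
  exists2 delta : R, 0 < delta <= 2^-1 &
  forall n (p : R), (N + K < n)%N -> 0 < p <= delta ->
    \sum_(1 <= k < K.+1) comp_weight p n k * moment p s (n - k)
    <= (1 + e) * (lam K p n * ((1 + e) * lam K p n ^+ s + e)).
Proof.
move=> e0 e1' HN; pose m : R := (K * K * s.+1)%:R + 1.
have m1 : 1 <= m by rewrite lerDr.
have d0 : 0 < e / 2 / m by rewrite !divr_gt0 // (lt_le_trans ltr01).
have dle : e / 2 / m <= 2^-1.
  by rewrite ler_pdivrMr ?(lt_le_trans ltr01) //; nra.
exists (e / 2 / m); first by rewrite d0.
move=> n p nNK /andP[p0 pd].
have p1 : p < 1 by lra.
have p01 : 0 <= p <= 1 by rewrite !ltW.
have Kn : (K < n)%N by apply: leq_trans nNK; rewrite ltnS leq_addl.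
have HNk k : (k <= K)%N -> moment p s (n - k) <= (1 + e) * lam K p (n - k) ^+ s + e.
  by move=> kK; apply: HN; [clear -nNK kK; lia | rewrite p0].
have H := main_terms_le p01 (ltW e0) Kn HNk.
have S0 : 0 <= \sum_(1 <= k < K.+1) comp_weight p n k * moment p s (n - k).
  by apply: sumr_ge0 => k _; rewrite mulr_ge0 ?comp_weight_ge0 ?moment_ge0.
apply: le_trans (ler_wpM2l _ H); last by lra.
rewrite mulrA ler_peMl //.
have Q := bernoulli_exprB (K * K * s.+1) p01.
have mp : (K * K * s.+1)%:R * p <= e / 2.
  apply: le_trans (_ : m * (e / 2 / m) <= _).
    by apply: ler_pM => //; rewrite ?ltW // /m; lra.
  by rewrite mulrCA divff ?mulr1 // gt_eqF // (lt_le_trans ltr01).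
nra.
Qed.

Lemma small_eta (B e : R) : 0 <= B -> 0 < e ->
  exists2 eta : R, 0 < eta <= e1^-1 & B * eta <= e.
Proof.
move=> B0 e0; have B1 : 0 < 1 + B by lra.
exists (Num.min e1^-1 (e / (1 + B))).
  by rewrite lt_min invr_gt0 expR_gt0 divr_gt0 //= ge_min lexx.
apply: le_trans (_ : B * (e / (1 + B)) <= _).
  by rewrite ler_wpM2l // ge_min lexx orbT.
by rewrite mulrA ler_pdivrMr // mulrC ler_pM2l //; lra.
Qed.

(** For p >= delta the number n q^(n/4) <= n exp(-delta n/5) tends to 0. *)
Lemma moment_large_p s (delta A e : R) : 0 < delta -> 0 <= A -> 0 < e ->
  (forall (p : R) n, 0 < p < 1 -> (0 < n)%N ->
    moment p s n <= A * (1 + (n%:R * (1 - p) ^+ n) ^+ s)) ->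
  exists N, forall n (p : R), (N <= n)%N -> delta <= p < 1 -> moment p s.+1 n <= e.
Proof.
move=> d0 A0 e0 HA.
have e10 : 0 < e1 := expR_gt0 1.
have B0 : 0 <= 12 * A * e1 by rewrite !mulr_ge0 // ltW.
have [eta /andP[eta0 eta1] eta2] := small_eta B0 e0.
have [M M1 HM] := @pow5_exp_small (delta * eta) (mulr_gt0 d0 eta0).
have [N1 HN1] := nat_above (M / delta).
exists (N1 + 4 * s + 16)%N => n p Nn /andP[dp p1].
have p0 : 0 < p by apply: lt_le_trans dp.
have p01 : 0 <= p <= 1 by rewrite !ltW.
have sn : (4 * s <= n)%N by clear -Nn; lia.
have n16 : (16 <= n)%N by clear -Nn; lia.
have n2 : (2 <= n)%N by clear -n16; lia.
have n0 : (0 < n)%N by clear -n16; lia.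
have Mt : M <= n%:R * delta.
  rewrite -ler_pdivrMr //; apply: le_trans HN1 _; rewrite ler_nat; clear -Nn; lia.
set z := n%:R * (1 - p) ^+ (n %/ 4).
have zeta : z <= eta.
  have t1 : 1 <= n%:R * delta by apply: le_trans Mt.
  have Ht := HM _ Mt.
  rewrite -(ler_pM2l d0); apply: le_trans Ht.
  rewrite /z mulrA [delta * _]mulrC; apply: ler_pM.
  - by rewrite mulr_ge0 // ltW.
  - by rewrite exprn_ge0 // subr_ge0 ltW.
  - by rewrite -[leLHS]expr1 ler_weXn2l.
  - apply: le_trans (expB_le_expR p01 (leq_5_div4 n16)) _.
    by rewrite ler_expR lerN2 ler_pM2r ?invr_gt0 // ler_wpM2l.
have HAp m : (0 < m)%N -> moment p s m <= A * (1 + (m%:R * (1 - p) ^+ m) ^+ s).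
  by move=> m0; apply: HA; rewrite ?p0.
have Hs := sum_small_dense p01 A0 HAp sn n2 (le_trans zeta eta1).
apply: le_trans (moment_split s p01 n0 (leq0n _)) _.
rewrite [X in _ * X + _]big_geq // mulr0 add0r.
apply: le_trans eta2.
have -> : 12 * A * e1 * eta = 3 * (4 * A * e1 * eta) by ring.
rewrite ler_pM2l //; apply: le_trans Hs _.
by rewrite ler_wpM2l // !mulr_ge0 // ltW.
Qed.

(** The constants are chosen in the order A, eta, M, K, delta, N: the bound M
    separates the two cases for n p and has to be fixed before K, because
    [tail_moderate] needs K >= exp(2M)^(s+1) / e; the threshold delta for p
    depends on K.  The factor 14 absorbs the errors collected at the end. *)
Lemma moment_upper_step s : moment_upper_estimate s -> moment_upper_estimate s.+1.
Proof.
move=> US eps eps0.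
have [A A0 HA] := moment_uniform_bound US.
have e10 : 0 < e1 := expR_gt0 1.
have [e [e0 e_le1 e_leps]] : exists e : R, [/\ 0 < e, 14 * e <= 1 & 14 * e <= eps].
  exists (Num.min eps 1 / 14).
  have -> : 14 * (Num.min eps 1 / 14) = Num.min eps 1 by field.
  by split; rewrite ?ge_min ?lexx ?orbT // divr_gt0 // lt_min eps0 ltr01.
have [K1 HK1] := US e e0.
have B0 : 0 <= 2 * A * e1 ^+ 6 by rewrite !mulr_ge0 ?exprn_ge0 // ltW.
have [eta /andP[eta0 eta1] eta2] := small_eta B0 e0.
have [M M1 HM] := pow5_exp_small eta0.
have [K2 HK2] := nat_above (expR (2 * M) ^+ s.+1 / e).
exists (K1 + K2 + 5)%N => K HK.
have K1K : (K1 <= K)%N by clear -HK; lia.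
have K2K : (K2 <= K)%N by clear -HK; lia.
have K5 : (5 <= K)%N by clear -HK; lia.
have K0 : (0 < K)%N by clear -HK; lia.
have [N1 HN1] := HK1 K K1K.
have e_le1' : e <= 1 by lra.
have [delta /andP[d0 d2] Hsmall] := main_terms_small_p e0 e_le1' HN1.
have [N3 HN3] := moment_large_p d0 A0 eps0 HA.
have [N4 HN4] := nat_above (4 * K%:R / e).
exists (N1 + K + 1 + 2 * K + N3 + N4 + 4 * s + 16)%N => n Nn p /andP[p0 p1].
have p01 : 0 <= p <= 1 by rewrite !ltW.
have mu0 : 0 <= n%:R * (1 - p) ^+ n by rewrite mulr_ge0 ?exprn_ge0 // subr_ge0 ltW.
have muL : n%:R * (1 - p) ^+ n <= lam K p n by apply: le_treesum => //; apply: ltW.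
have L0 := le_trans mu0 muL.
have [dp|pd] := leP delta p.
  apply: le_trans (HN3 n p _ _) _; [by clear -Nn; lia | by rewrite dp | ].
  rewrite lerDr mulr_ge0 ?exprn_ge0 //; lra.
have n0 : (0 < n)%N by clear -Nn; lia.
have Kn : (K <= n./2)%N by clear -Nn; lia.
have NKn : (N1 + K < n)%N by clear -Nn; lia.
have sn : (4 * s <= n)%N by clear -Nn; lia.
have n16 : (16 <= n)%N by clear -Nn; lia.
have n2 : (n./2.+1 <= n)%N by clear -n16; lia.
have cK : 1 + 4 * K%:R / n%:R <= 1 + e.
  rewrite lerD2l ler_pdivrMr ?ltr0n // [leRHS]mulrC -ler_pdivrMr //.
  by apply: le_trans HN4 _; rewrite ler_nat; clear -Nn; lia.
have pdelta : 0 < p <= delta by rewrite p0 ltW.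
have HX := Hsmall n p NKn pdelta.
apply: le_trans (moment_split s p01 n0 Kn) _.
set L := lam K p n in muL L0 HX *; set mu := n%:R * (1 - p) ^+ n in mu0 muL *.
have L0' : 0 <= L ^+ s.+1 by rewrite exprn_ge0.
have LL : L <= 1 + L ^+ s.+1 := le1DX s L0.
have muL' : mu ^+ s.+1 <= L ^+ s.+1 by rewrite lerXn2r.
(* The sizes between K and n/2, according to whether n p <= M. *)
have HY : \sum_(K.+1 <= k < n./2.+1) comp_weight p n k * moment p s (n - k)
    <= e * (1 + L ^+ s.+1).
  have [tM|Mt] := leP (n%:R * p) M.
    have p2 : 0 <= p <= 2^-1 by lra.
    have HA' := tail_moderate s K p2 tM n0 n2.
    have KR : 0 < K%:R :> R by rewrite ltr0n.
    rewrite -(ler_pM2l KR); apply: le_trans HA' _.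
    have HE : expR (2 * M) ^+ s.+1 <= K%:R * e.
      by rewrite -ler_pdivrMr //; apply: le_trans HK2 _; rewrite ler_nat.
    apply: le_trans (_ : (K%:R * e) * L ^+ s.+1 <= _).
      by apply: ler_pM => //; rewrite exprn_ge0 ?expR_ge0.
    rewrite -mulrA ler_wpM2l ?(ltW KR) // ler_wpM2l ?(ltW e0) //; lra.
  have HAp m : (0 < m)%N -> moment p s m <= A * (1 + (m%:R * (1 - p) ^+ m) ^+ s).
    by move=> m0; apply: HA; rewrite ?p0.
  have t1 : 1 <= n%:R * p by apply: le_trans M1 (ltW Mt).
  have q0 : 0 <= (1 - p) ^+ (n %/ 4) by rewrite exprn_ge0 // subr_ge0 ltW.
  have etaP : (n%:R * p) ^+ 5 * (1 - p) ^+ (n %/ 4) <= eta.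
    apply: le_trans (HM _ (ltW Mt)).
    by rewrite ler_wpM2l ?exprn_ge0 ?(le_trans ler01) // expB_le_expR // leq_5_div4.
  have epz : e1 * (p * (n%:R * (1 - p) ^+ (n %/ 4))) <= 1.
    rewrite mulrC -ler_pdivlMr // div1r; apply: le_trans eta1.
    apply: le_trans etaP; rewrite mulrA [p * _]mulrC ler_wpM2r //.
    by rewrite -[leLHS]expr1 ler_weXn2l.
  apply: le_trans (tail_dense p01 A0 HAp sn n16 K5 epz etaP) _.
  rewrite -/mu.
  have mumu : mu + mu ^+ s.+1 <= 2 * (1 + L ^+ s.+1) by lra.
  have -> : A * (1 + mu ^+ s) * (e1 ^+ 6 * (mu * eta))
    = (A * e1 ^+ 6 * eta) * (mu + mu ^+ s.+1) by rewrite [mu ^+ s.+1]exprS; ring.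
  apply: le_trans (ler_wpM2l _ mumu) _.
    by rewrite !mulr_ge0 ?exprn_ge0 // ltW.
  rewrite mulrA ler_wpM2r ?addr_ge0 //.
  by apply: le_trans eta2; rewrite le_eqVlt; apply/orP; left; apply/eqP; ring.
have X0 : 0 <= \sum_(1 <= k < K.+1) comp_weight p n k * moment p s (n - k).
  by apply: sumr_ge0 => k _; rewrite mulr_ge0 ?comp_weight_ge0 ?moment_ge0.
(* It remains to collect the errors; X are the main terms, Y the middle sizes
   and L' stands for L^(s+1). *)
have HXc := ler_wpM2r X0 cK.
have LE : L * ((1 + e) * L ^+ s + e) = (1 + e) * L ^+ s.+1 + e * L.
  by rewrite [L ^+ s.+1]exprS; ring.
rewrite LE in HX.
move: HX HY HXc X0; move: (\sum_(1 <= k < K.+1) _) (\sum_(K.+1 <= k < _) _) => X Y.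
move: (_ + 4 * _ / _) => cc.
move: (L ^+ s.+1) LL L0' => L' LL L0' HX HY HXc X0.
clear -e0 e_le1 e_leps LL L0' HX HY HXc X0 L0.
have b1 : (1 + e) * L' + e * L <= (1 + 2 * e) * L' + e by nra.
have b2 : X <= (1 + 4 * e) * L' + 2 * e.
  apply: le_trans HX _; apply: le_trans (ler_wpM2l _ b1) _; first lra.
  have ee : e * e <= e / 14 by nra.
  have ee0 : 0 <= e * e by nra.
  have : (e * e) * L' <= e / 14 * L' by rewrite ler_wpM2r.
  nra.
have b3 : (1 + e) * X <= (1 + 6 * e) * L' + 3 * e.
  apply: le_trans (ler_wpM2l _ b2) _; first lra.
  have ee : e * e <= e / 14 by nra.
  have : (e * e) * L' <= e / 14 * L' by rewrite ler_wpM2r.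
  nra.
have b4 : 14 * e * L' <= eps * L' by rewrite ler_wpM2r.
nra.
Qed.

Lemma moment_upper s : moment_upper_estimate s.
Proof.
elim: s => [|s IH]; last exact: moment_upper_step.
move=> e e0; exists 0%N => K _; exists 0%N => n _ p /andP[p0 p1].
by rewrite moment0 ?expr0; [lra | rewrite !ltW].
Qed.

End UpperBound.

(** * Comparison with the tree series *)

Section Comparison.
Variable R : realType.
Local Notation e1 := (expR (1 : R)).
Local Notation lam K p n := (treesum K p (n%:R * (1 - p) ^+ n)).

(** The s-th derivative of z^X at z = 1 is the falling power X^_s. *)
Lemma expectation_moment (p : R) s n : (0 < n)%N ->
  Gnp_expectation p (fun G : {set {set 'I_n}} => ((ncomponents G - 1) ^_ s)%:R)
  = moment p s n.
Proof.
case: n => // n _; rewrite /moment /=.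
have cT : #|[set: 'I_n.+1] :\: [set ord0]%SET| = n.
  by have := cardsD1 ord0 [set: 'I_n.+1]; rewrite cardsT card_ord inE add1n => -[<-].
rewrite -[in RHS]cT -[in RHS](cards1 (ord0 : 'I_n.+1)) -mean_compgf ?subsetT //.
rewrite /Gnp_mean /Gnp_expectation linear_sum horner_sum.
apply: eq_bigr => G _; rewrite linearZ hornerZ /= derivnXn hornerMn hornerXn expr1n.
by rewrite ncomponentsE (ncomp_avoiding0 G (in_setT ord0)) subSS subn0.
Qed.

Definition tree_mean (p : R) n := p^-1 * tree_series (n%:R * p * (1 - p) ^+ n).

Lemma tree_mean_bounds K (p : R) n : (0 < K)%N -> 0 < p < 1 ->
  lam K p n <= tree_mean p n <= lam K p n + e1 * (n%:R * (1 - p) ^+ n) / K%:R.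
Proof.
move=> K0 /andP[p0 p1]; rewrite /tree_mean -mulrA mulrCA.
apply: tree_series_bounds; rewrite ?mulr_ge0 ?exprn_ge0 ?subr_ge0 ?tree_arg_le //.
  exact: ltW.
by rewrite (ltW p0) ltW.
Qed.

(** The upper bound is [moment_upper], as a truncated sum is at most the series.
    For the lower bound, the truncation at K costs a factor 1 - e1/K and the
    shift of n by s K in [moment_lower] a factor (1 - s K/n)^K; both are close to
    1 by Bernoulli's inequality, uniformly in p. *)
Lemma moment_close s (e : R) : (1 <= s)%N -> 0 < e -> exists N, forall n, (N <= n)%N ->
  forall p : R, 0 < p < 1 ->
  `|moment p s n - tree_mean p n ^+ s| <= e * (1 + tree_mean p n ^+ s).
Proof.
move=> s1 eps0; have [e' [e0 e_le1 e_le]] : exists e' : R, [/\ 0 < e', e' <= 1 & e' <= e].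
  by exists (Num.min e 1); rewrite lt_min eps0 ltr01 !ge_min !lexx orbT.
have [K1 HK1] := @moment_upper R s e' e0.
have [K2 HK2] := nat_above (2 * s%:R * e1 / e').
pose K := (K1 + K2 + 1)%N.
have [N1 HN1] := HK1 K (leq_trans (leq_addr K2 K1) (leq_addr 1 _)).
have [N2 HN2] := nat_above (2 * s%:R * (s * K * K)%:R / e').
exists (N1 + N2 + s * K + 1)%N => n Nn p p01'; have /andP[p0 p1] := p01'.
have p01 : 0 <= p <= 1 by rewrite !ltW.
have K0 : (0 < K)%N by rewrite /K addn1.
have KR : 0 < K%:R :> R by rewrite ltr0n.
have n0 : (0 < n)%N by clear -Nn; lia.
have nR : 0 < n%:R :> R by rewrite ltr0n.
have q0 : 0 <= (1 - p) ^+ n by rewrite exprn_ge0 // subr_ge0 ltW.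
have mu0 : 0 <= n%:R * (1 - p) ^+ n by rewrite mulr_ge0.
have /andP[lamT Tlam] := @tree_mean_bounds K p n K0 p01'.
have mulam : n%:R * (1 - p) ^+ n <= lam K p n by apply: le_treesum => //; apply: ltW.
have lam0 : 0 <= lam K p n := le_trans mu0 mulam.
move: (tree_mean p n) lamT Tlam => T lamT Tlam.
have T0 : 0 <= T := le_trans lam0 lamT.
have Ts0 : 0 <= T ^+ s by rewrite exprn_ge0.
have up : moment p s n <= T ^+ s + e * (1 + T ^+ s).
  apply: le_trans (HN1 n _ p p01') _; first by clear -Nn; lia.
  have H : lam K p n ^+ s <= T ^+ s by rewrite lerXn2r.
  apply: le_trans (_ : (1 + e') * T ^+ s + e' <= _).
    by rewrite lerD2r ler_wpM2l //; lra.
  have : e' * T ^+ s <= e * T ^+ s by rewrite ler_wpM2r.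
  lra.
have low : T ^+ s - e * (1 + T ^+ s) <= moment p s n.
  have sKn : (s * K < n)%N by clear -Nn; lia.
  apply: le_trans (moment_lower p01 sKn).
  pose t : R := (s * K)%:R / n%:R.
  have t0 : 0 <= t by rewrite divr_ge0.
  have t1 : t <= 1 by rewrite ler_pdivrMr // mul1r ler_nat ltnW.
  have -> : (n - s * K)%:R * (1 - p) ^+ n = (1 - t) * (n%:R * (1 - p) ^+ n).
    by rewrite natrB ?(ltnW sKn) // /t; field; rewrite gt_eqF.
  have t01 : 0 <= 1 - t <= 1 by rewrite subr_ge0 t1 gerBl.
  pose u : R := e1 / K%:R.
  have u0 : 0 <= u by rewrite divr_ge0 ?expR_ge0.
  have su : s%:R * u <= e' / 2.
    rewrite /u mulrA ler_pdivrMr //.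
    have : 2 * s%:R * e1 <= K%:R * e'.
      rewrite -ler_pdivrMr //; apply: le_trans HK2 _.
      by rewrite ler_nat /K -addnA addnCA leq_addr.
    clear; move: (s%:R) (e1) (K%:R) => x y z; lra.
  have st : s%:R * (K%:R * t) <= e' / 2.
    rewrite /t !mulrA ler_pdivrMr //.
    have : 2 * s%:R * (s * K * K)%:R <= n%:R * e'.
      rewrite -ler_pdivrMr //; apply: le_trans HN2 _; rewrite ler_nat.
      by clear -Nn; lia.
    rewrite !natrM; clear; move: (s%:R) (n%:R) (K%:R) => x y z; lra.
  have sR : 1 <= s%:R :> R by rewrite ler1n.
  have Kt0 : 0 <= K%:R * t by rewrite mulr_ge0.
  pose x := K%:R * t + u.
  have x0 : 0 <= x by rewrite addr_ge0.
  have sx : s%:R * x <= e' by rewrite mulrDr; clear -su st; lra.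
  have x1 : x <= 1 by apply: le_trans e_le1; apply: le_trans sx; rewrite ler_peMl.
  have Tu : (1 - u) * T <= lam K p n.
    have : u * (n%:R * (1 - p) ^+ n) <= u * T by rewrite ler_wpM2l // (le_trans mulam).
    have : e1 * (n%:R * (1 - p) ^+ n) / K%:R = u * (n%:R * (1 - p) ^+ n).
      by rewrite mulrAC.
    move: Tlam; clear; move: (_ / K%:R) (lam K p n) => X Y; lra.
  have yT : (1 - x) * T <= treesum K p ((1 - t) * (n%:R * (1 - p) ^+ n)).
    apply: le_trans (treesum_scale_ge (ltW p0) K t01 mu0).
    have Kt := bernoulli_exprB K (introT andP (conj t0 t1)).
    apply: le_trans (ler_wpM2r lam0 Kt).
    have Kt1 : 0 <= 1 - K%:R * t by clear -x1 u0; rewrite /x in x1; lra.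
    apply: le_trans (ler_wpM2l Kt1 Tu); rewrite [leRHS]mulrA ler_wpM2r //.
    have : 0 <= (K%:R * t) * u by rewrite mulr_ge0.
    by rewrite /x; clear; move: (K%:R * t) => a; lra.
  apply: le_trans (_ : ((1 - x) * T) ^+ s <= _); last first.
    by rewrite lerXn2r ?nnegrE ?(le_trans _ yT) // mulr_ge0 // subr_ge0.
  rewrite exprMn.
  have := ler_wpM2r Ts0 (bernoulli_exprB s (introT andP (conj x0 x1))).
  apply: le_trans.
  have : s%:R * x * T ^+ s <= e * T ^+ s by rewrite ler_wpM2r // (le_trans sx).
  move: eps0; clear; move: (s%:R * x) (T ^+ s) => a b; lra.
rewrite ler_norml; apply/andP; split; move: low up; clear; lra.
Qed.

End Comparison.

Local Open Scope classical_set_scope.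

(* [m ^_ s] is the falling power of m : nat; for n >= 1 there is at least one
   component, so the truncated subtraction in nu_n - 1 is exact. *)
Theorem mainTheorem1 (R : realType) (s : nat) (p : nat -> R)
    (hs : (1 <= s)%N) (hp : forall n, 0 < p n < 1) :
  exists a b : nat -> R,
    [/\ a n @[n --> \oo] --> (0 : R),
        b n @[n --> \oo] --> (0 : R) &
        \forall n \near \oo,
          Gnp_expectation (p n)
            (fun G : {set {set 'I_n}} => ((ncomponents G - 1) ^_ s)%:R)
          = (1 + a n)
            * ((p n)^-1 * tree_series (n%:R * p n * (1 - p n) ^+ n)) ^+ s
            + b n].
Proof.
(* By [moment_close], |F - T| <= e (1 + T) for large n.  The error is relative
   where T >= 1 and absolute elsewhere. *)
pose F n := moment (p n) s n.
pose T n := tree_mean (p n) n ^+ s.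
exists (fun n => if 1 <= T n then (F n - T n) / T n else 0).
exists (fun n => if 1 <= T n then 0 else F n - T n).
have close e : 0 < e -> \forall n \near \oo, `|F n - T n| <= e * (1 + T n).
  move=> e0; have [N HN] := moment_close hs e0.
  by exists N => // n Nn; apply: HN.
have T0 n : 0 <= T n.
  have /andP[p0 p1] := hp n.
  have /andP[H _] := @tree_mean_bounds R 1 (p n) n isT (hp n).
  rewrite exprn_ge0 // (le_trans _ H) // treesum_ge0 ?(ltW p0) //.
  by rewrite mulr_ge0 // exprn_ge0 // subr_ge0 ltW.
split.
- apply/cvgrPdist_le => e e0; near=> n.
  rewrite sub0r normrN; case: ifPn => [T1|_]; last by rewrite normr0 ltW.
  have Tp : 0 < T n by apply: lt_le_trans T1.
  rewrite normrM normfV (gtr0_norm Tp) ler_pdivrMr //.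
  have H : `|F n - T n| <= e / 2 * (1 + T n) by near: n; apply: close; rewrite divr_gt0.
  apply: le_trans H _; rewrite -mulrA ler_pM2l //; lra.
- apply/cvgrPdist_le => e e0; near=> n.
  rewrite sub0r normrN; case: ifPn => [_|]; first by rewrite normr0 ltW.
  rewrite -ltNge => T1.
  have H : `|F n - T n| <= e / 2 * (1 + T n) by near: n; apply: close; rewrite divr_gt0.
  apply: le_trans H _; rewrite -mulrA ger_pMr //; lra.
- near=> n.
  have n0 : (0 < n)%N by near: n; exists 1%N.
  rewrite expectation_moment // -/(tree_mean (p n) n) -/(F n) -/(T n).
  case: ifPn => [T1|_]; last by rewrite addr0 mul1r addrC subrK.
  have Tp : 0 < T n by apply: lt_le_trans T1.
  by rewrite addr0 mulrDl mul1r divfK ?gt_eqF // addrC subrK.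
Unshelve. all: by end_near.
Qed.
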